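(* Let $\omega>0$ with $\omega\neq 2n\pi$ for all integers $n\ge1$. Let $r\ge1$ and let $f\colon[0,1]\times[-r,r]\to[0,+\infty)$ be continuous and such that $f(t,u)>0$ whenever $0\le t\le 1$ and $2\omega^{-1}|\sin(\tfrac12\omega)|\le|u|\le r$. Then for every $p\in[1,+\infty)$ there exists a parameter $\lambda=\lambda(\omega,p)>0$ such that the periodic boundary value problem $x''(t)+\omega^2x(t)=\lambda f(t,x(t))$, $t\in[0,1]$, $x(0)=x(1)$, $x'(0)=x'(1)$, has a solution $x\colon[0,1]\to[-r,r]$ with $\bigl(\int_0^1|x(t)|^p\,dt\bigr)^{1/p}=2\omega^{-1}|\sin(\tfrac12\omega)|$.
   Context: A solution of the boundary value problem is a twice continuously differentiable function $x\colon[0,1]\to\mathbb R$ satisfying the differential equation on $[0,1]$ and the two periodic boundary conditions. *)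

(* Defs.v *)
From Stdlib Require Import Reals.
From Coquelicot Require Import Coquelicot.
Open Scope R_scope.

(* a ^ q for a >= 0 and real q > 0, with the convention 0 ^ q = 0
   (Stdlib's Rpower 0 q would give 1). *)
Definition rpow (a q : R) : R := if Rle_dec a 0 then 0 else Rpower a q.

(* L^p norm on [0,1]: (int_0^1 |x t|^p dt)^(1/p) (Riemann integral; x is continuous). *)
Definition Lp_norm01 (p : R) (x : R -> R) : R :=
  rpow (RInt (fun t => rpow (Rabs (x t)) p) 0 1) (1 / p).

Definition cont_on_rect (r : R) (f : R -> R -> R) : Prop :=
  forall t u, 0 <= t <= 1 -> -r <= u <= r ->
  forall eps, 0 < eps -> exists delta, 0 < delta /\
    forall t' u', 0 <= t' <= 1 -> -r <= u' <= r ->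
      Rabs (t' - t) < delta -> Rabs (u' - u) < delta ->
      Rabs (f t' u' - f t u) < eps.

Definition is_periodic_solution (omega lam : R) (f : R -> R -> R) (x : R -> R) : Prop :=
  exists x1 x2 : R -> R,
    (forall t, 0 <= t <= 1 ->
       is_derive x t (x1 t) /\ is_derive x1 t (x2 t) /\ continuous x2 t) /\
    (forall t, 0 <= t <= 1 -> x2 t + omega ^ 2 * x t = lam * f t (x t)) /\
    x 0 = x 1 /\ x1 0 = x1 1.

(* Main.v *)
Require Import Defs.
From Stdlib Require Import Reals ZArith Lra Lia Classical ClassicalEpsilon.
From Coquelicot Require Import Coquelicot.
From mathcomp Require all_boot zify.
Open Scope R_scope.

(* The periodic problem x'' + omega^2 x = h is inverted by the kernel
   G(t,s) = cos(omega (1/2 - |t - s|)) / (2 omega sin(omega/2)), which changes sign but has all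
   column integrals equal to 1 / omega^2.  Put rho = 2 / omega * |sin(omega/2)|,
   K(y) = rho / |y|_p and Psi(y)(s) = f(s, K(y) y(s)).  If y is the image under G of a
   probability density, then |y|_p >= int y = 1 / omega^2 while |G| <= 1 / (omega^2 rho), so
   x = K(y) y has norm rho and |x| <= 1 <= r; moreover |x| >= rho somewhere, whence
   int Psi(y) > 0.  So it suffices to find y with (int Psi(y)) y = G Psi(y).
   Replace the density by atoms of masses w_i at i/N and label w by some i such that the cell i
   receives at least the fraction w_i of the total mass of Psi(G w).  Scarf's lemma gives a
   small cluster of grid points of the simplex carrying every label whose coordinate is not
   negligible; since both sides sum up to 1, such a cluster is an approximate fixed point, and
   Arzela-Ascoli lets N tend to infinity. *)

(** * Scarf's lemma *)

Module Scarf.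
Import all_boot zify.
Local Open Scope nat_scope.
Set Implicit Arguments.
Unset Strict Implicit.
Unset Printing Implicit Defensive.

(** The obstacle is the normalization: [K] degenerates where the norm of [y] vanishes, and a kernel
    of changing sign could well produce such [y]. The constant column integral excludes this.
    Whatever probability measure [G] is applied to, the result has mean 1 / omega^2, and by
    convexity the L^p norm is at least the mean. Hence the search runs over measures, and continuity
    of [Psi] is required only at functions with that mean. The eigenfunction equation keeps the
    factor int Psi(y) on the left instead of dividing by it, so its positivity is needed only once,
    for the final [y]. The parameter is then lambda = K(y) / int Psi(y): prescribing the norm of the
    solution is paid for by leaving lambda free. *)

Lemma imset_deficit1 (S S' : finType) (f : S -> S') (A : {set S}) :
  #|A| = #|f @: A|.+1 ->
  exists a b : S, [/\ a \in A, b \in A & a != b] /\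
    (f a = f b /\ {in A :\ a &, injective f}).
Proof.
move=> cA.
have /dinjectivePn[a aA [b /andP[nba bA] fab]] : ~~ dinjectiveb f A.
  by apply/dinjectiveP => /card_in_imset; lia.
exists a, b; split; first by split; rewrite // eq_sym.
split=> //; apply/imset_injP; apply/eqP.
have -> : f @: (A :\ a) = f @: A.
  apply/setP => y; apply/imsetP/imsetP => -[x].
    by rewrite in_setD1 => /andP[_ xA] ->; exists x.
  move=> xA ->; have [->|nxa] := eqVneq x a.
    by exists b => //; rewrite in_setD1 nba.
  by exists x => //; rewrite in_setD1 nxa.
by have := cardsD1 a A; rewrite aA; lia.
Qed.

Section Rooms.

Variables (I T : finType) (i0 : I) (t0 : T) (r : I -> T -> nat) (c : T -> I).
Hypothesis r_inj : forall i, injective (r i).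

Local Notation V := (I + T)%type.

(* The i-th order extended to the slack vertices: slack i comes first, the other slacks last. *)
Definition rank (i : I) (v : V) : nat :=
  match v with
  | inl j => if j == i then 0 else (\max_t r i t).+2 + enum_rank j
  | inr t => (r i t).+1
  end.

Definition colour (v : V) : I := match v with inl j => j | inr t => c t end.

(** Scarf's primitive sets: no point of [T] lies strictly above the minimum of [Z] in all orders at
    once. *)
Definition dominant (Z : {set V}) : bool :=
  [forall t, exists i, forall z in Z, rank i (inr t) <= rank i z].

Lemma dominantP (Z : {set V}) :
  reflect (forall t, exists i, forall z, z \in Z -> rank i (inr t) <= rank i z)
          (dominant Z).
Proof.
apply: (iffP forallP) => H t; have := H t.
  by case/existsP => i /forall_inP; exists i.
by case=> i Hi; apply/existsP; exists i; apply/forall_inP.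
Qed.

Lemma dominantPn (Z : {set V}) (t : T) :
  (forall i, exists2 z, z \in Z & rank i z < rank i (inr t)) -> ~~ dominant Z.
Proof.
move=> H; apply/negP => /dominantP/(_ t)[i Hi].
by have [z zZ] := H i; rewrite ltnNge Hi.
Qed.

Lemma rank_inr_lt i j t : j != i -> rank i (inr t) < rank i (inl j).
Proof.
by move=> /negbTE nji /=; rewrite nji; have := @leq_bigmax _ (r i) t; lia.
Qed.

Lemma rank_inj i : injective (rank i).
Proof.
move=> [j|t] [j'|t'].
- rewrite /=; case: eqP => [->|_]; case: eqP => [->|_] //=; try lia.
  by move=> h; congr inl; apply/enum_rank_inj/val_inj => /=; lia.
- have [->|/(rank_inr_lt t')] := eqVneq j i; first by rewrite /= eqxx.
  by move=> + h; rewrite h ltnn.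
- have [->|/(rank_inr_lt t)] := eqVneq j' i; first by rewrite /= eqxx.
  by move=> + h; rewrite h ltnn.
- by move=> /= [/r_inj ->].
Qed.

Lemma dominantS (Y Z : {set V}) : Y \subset Z -> dominant Z -> dominant Y.
Proof.
move=> /subsetP sYZ /dominantP H; apply/dominantP => t.
by have [i Hi] := H t; exists i => z /sYZ; apply: Hi.
Qed.

(** Thus sending an order to its minimum maps [I] onto a dominant set. All the counting of rooms
    around a door rests on this surjection. *)
Lemma dominant_min (Z : {set V}) z : dominant Z -> z \in Z ->
  exists i, forall z', z' \in Z -> rank i z <= rank i z'.
Proof.
case: z => [j|t] /dominantP H zZ; last exact: H.
by exists j => z' _; rewrite /= eqxx.
Qed.

(* Rooms are the dominant sets of size #|I|; their facets, being dominant too, are doors as soon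
   as they carry all colours but i0. *)
Lemma odd_doors_of_room (Z : {set V}) : #|Z| = #|I| ->
  odd #|[set z in Z | colour @: (Z :\ z) == ~: [set i0]]| =
  (colour @: Z == setT).
Proof.
move=> cZ; have cI0 : #|~: [set i0]| = #|I|.-1 by rewrite cardsC1.
have Ipos : 0 < #|I| by apply/card_gt0P; exists i0.
case: eqP => [fullZ|nfull].
  have injZ : {in Z &, injective colour}.
    by apply/imset_injP; rewrite fullZ cardsT cZ.
  have /imsetP[z0 z0Z ez0] : i0 \in colour @: Z by rewrite fullZ inE.
  suff -> : [set z in Z | colour @: (Z :\ z) == ~: [set i0]] = [set z0].
    by rewrite cards1.
  apply/setP => z; rewrite !inE; apply/andP/eqP => [[zZ /eqP e]|->].
    apply/eqP; apply: contraT => nz; have : i0 \in ~: [set i0].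
      by rewrite -e {1}ez0 imset_f // in_setD1 z0Z eq_sym nz.
    by rewrite !inE eqxx.
  split=> //; apply/eqP/setP => i; rewrite !inE; apply/imsetP/idP.
    move=> [z1]; rewrite in_setD1 => /andP[nz zZ] ->; apply: contra nz => /eqP e.
    by apply/eqP/injZ; rewrite // e.
  move=> ni; have /imsetP[z1 zZ ez] : i \in colour @: Z by rewrite fullZ inE.
  exists z1 => //; rewrite in_setD1 zZ andbT; apply: contra ni => /eqP zz.
  by rewrite ez zz ez0.
have [->|/set0Pn[z0]] := eqVneq [set z in Z | colour @: (Z :\ z) == ~: [set i0]] set0.
  by rewrite cards0.
rewrite inE => /andP[z0Z /eqP e0].
have imZ : colour @: Z = ~: [set i0].
  have nz0 : colour z0 != i0.
    apply/eqP => ez0; apply: nfull; rewrite -(setD1K z0Z) imsetU1 e0 ez0.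
    by apply/setP => i; rewrite !inE orbN.
  rewrite -(setD1K z0Z) imsetU1 e0; apply/setP => i; rewrite !inE.
  by have [->|] := eqVneq i (colour z0).
(* The colours miss only [i0], so exactly one pair of vertices shares a colour; removing either of
   the two keeps all colours, removing any other vertex loses one. *)
have [|a [b [[aZ bZ nab] [fab inja]]]] := @imset_deficit1 _ _ colour Z.
  by rewrite imZ cI0 cZ; lia.
suff -> : [set z in Z | colour @: (Z :\ z) == ~: [set i0]] = [set a; b].
  by rewrite cards2 nab.
have imD u v : u \in Z -> v \in Z -> v != u -> colour u = colour v ->
    colour @: (Z :\ u) = colour @: Z.
  move=> uZ vZ nvu fuv; apply/setP => y; apply/imsetP/imsetP => -[x].
    by rewrite in_setD1 => /andP[_ xA] ->; exists x.
  move=> xA ->; have [->|nxu] := eqVneq x u.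
    by exists v => //; rewrite in_setD1 nvu.
  by exists x => //; rewrite in_setD1 nxu.
apply/setP => z; rewrite !inE; apply/andP/orP => [[zZ /eqP e]|].
  have /imsetP[z' ] : colour z \in colour @: (Z :\ z) by rewrite e -imZ imset_f.
  rewrite in_setD1 => /andP[nz' z'Z] ez.
  have [_|nza] := eqVneq z a; first by left.
  have [_|nzb] := eqVneq z b; first by right.
  have [z'a|nz'a] := eqVneq z' a.
    by move: nzb; rewrite (inja z b) ?eqxx // ?in_setD1 ?nza ?zZ ?bZ ?(eq_sym b) ?nab // ez z'a.
  by move: nz'; rewrite (inja z z') ?eqxx // ?in_setD1 ?nza ?nz'a ?zZ ?z'Z.
by case=> /eqP ->; split => //; rewrite -imZ; apply/eqP;
   [apply: (imD a b)|apply: (imD b a)]; rewrite // eq_sym.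
Qed.

(** A slack of [Y] has rank 0 in its own order, so only the order [i0] can witness dominance. The
    added vertex must therefore be the largest point of [T] in that order; the slack of [i0] would
    leave no witness at all. *)
Lemma rooms_of_outer_door (Y : {set V}) : Y = (@inl I T) @: (~: [set i0]) ->
  #|[set z | (z \notin Y) && dominant (z |: Y)]| = 1.
Proof.
move=> YE; have inY j : (inl j \in Y) = (j != i0).
  by rewrite YE mem_imset ?inE // => ? ? [].
have rY t : inr t \notin Y by rewrite YE; apply/negP => /imsetP[].
have [tm _ tmP] := @arg_maxnP T t0 predT (r i0) isT.
apply/eqP/cards1P; exists (inr tm); apply/setP => z; rewrite !inE.
have domr t : dominant (inr t |: Y) = (r i0 tm <= r i0 t).
  apply/dominantP/idP => [/(_ tm)[i Hi]|le t'].
    have [e|ni] := eqVneq i i0; first by have := Hi (inr t); rewrite !inE eqxx e; apply.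
    by have := Hi (inl i); rewrite !inE inY ni /= eqxx; move/(_ isT).
  exists i0 => z'; rewrite !inE => /orP[/eqP ->|].
    by rewrite /= ltnS (leq_trans _ le) //; apply: tmP.
  case: z' => [j|t'']; last by rewrite (negbTE (rY _)).
  by rewrite inY => nj; apply/ltnW/rank_inr_lt.
apply/andP/eqP => [[zY dz]|->]; last by rewrite rY domr.
case: z => [j|t] in zY dz *.
  have /eqP ej : j == i0 by move: zY; rewrite inY negbK.
  have /dominantP/(_ t0)[i Hi] := dz.
  suff : inl i \in inl j |: Y by move/Hi; rewrite /= eqxx.
  by rewrite in_setU1 inY ej; have [->|] := eqVneq i i0; rewrite ?eqxx ?orbT.
congr inr; apply/(@r_inj i0)/eqP; rewrite eqn_leq.
by apply/andP; split; [exact: tmP | rewrite -domr].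
Qed.

(** The map [m] of minima is onto [Y], which has one element less than [I], so exactly two orders
    [j] and [k] share a minimum. A new vertex must take over the minimum of one of them, and in each
    of the two cases it is determined uniquely. *)
Lemma rooms_of_inner_door (Y : {set V}) (t1 : T) :
  inr t1 \in Y -> dominant Y -> #|I| = #|Y|.+1 ->
  #|[set z | (z \notin Y) && dominant (z |: Y)]| = 2.
Proof.
move=> t1Y domY cY.
pose m i := [arg min_(v < inr t1 in Y) rank i v].
have mP i : m i \in Y /\ forall v, v \in Y -> rank i (m i) <= rank i v.
  by rewrite /m; case: arg_minnP.
have mE i v : v \in Y -> (forall z, z \in Y -> rank i v <= rank i z) -> m i = v.
  move=> vY vmin; apply: (@rank_inj i); apply/eqP.
  by rewrite eqn_leq vmin ?(mP i).2 ?(mP i).1.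
have imm : m @: setT = Y.
  apply/setP => v; apply/imsetP/idP => [[i _ ->]|vY]; first exact: (mP i).1.
  have [i Hi] := dominant_min domY vY.
  by exists i; rewrite ?inE ?(mE i v).
have [|j [k [[_ _ njk] [mjk _]]]] := @imset_deficit1 _ _ m setT.
  by rewrite imm cardsT.
have slack_lt i : rank i (m i) < (\max_t r i t).+2.
  have := (mP i).2 _ t1Y => /=; have := @leq_bigmax _ (r i) t1; lia.
(* Vertices whose addition can change the minimum in the order [l] only. The slack of [l] is one,
   because [t1] keeps every minimum of [Y] below the foreign slacks; the largest element [x l] is
   the candidate for the new vertex. *)
pose A l := [pred v : V | [forall (i | i != l), rank i (m i) < rank i v]].
have slackA l : inl l \in A l.
  rewrite inE; apply/forall_inP => i nil /=.
  by rewrite eq_sym (negbTE nil); have := slack_lt i; lia.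
pose x l := [arg max_(v > inl l | v \in A l) rank l v].
have xP l : x l \in A l /\ forall v, v \in A l -> rank l v <= rank l (x l).
  by rewrite /x; case: arg_maxnP => // v vA vmax; split=> // w /vmax.
have surj l v : l \in [set j; k] -> v \in Y -> exists2 i, i != l & m i = v.
  move=> lp; rewrite -imm => /imsetP[i _ ->].
  have [->|nil] := eqVneq i l; last by exists i.
  move: lp; rewrite !inE => /orP[]/eqP ->.
    by exists k; rewrite // eq_sym.
  by exists j.
have AY l v : l \in [set j; k] -> v \in A l -> v \notin Y.
  move=> lp /forall_inP vA; apply/negP => vY.
  have [i nil e] := surj l v lp vY.
  by have := vA i nil; rewrite e ltnn.
(* Otherwise a point of [T] in [A l] would lie above all minima of [Y], against dominance. *)
have Alt l v : l \in [set j; k] -> v \in A l -> rank l v < rank l (m l).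
  move=> lp vA; rewrite ltn_neqAle; apply/andP; split.
    apply: contra (AY l v lp vA) => /eqP/(@rank_inj l) ->; exact: (mP l).1.
  move: vA => /forall_inP; case: v => [q|t] vA.
    have [->|nql] := eqVneq q l; first by rewrite /= eqxx.
    by have := vA q nql; rewrite /= eqxx.
  have /dominantP/(_ t)[i Hi] := domY.
  have [ei|nil] := eqVneq i l; first by rewrite -ei; apply: Hi; exact: (mP i).1.
  by have := vA i nil; rewrite ltnNge Hi // (mP i).1.
have xdom l : l \in [set j; k] -> dominant (x l |: Y).
  move=> lp; apply: contraT => /forallPn[t]; rewrite negb_exists => /forallP Ht.
  have {}Ht i : exists2 z, z \in x l |: Y & rank i z < rank i (inr t).
    by have /forall_inPn[z zY] := Ht i; rewrite -ltnNge; exists z.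
  have [xA xmax] := xP l.
  have tA : inr t \in A l.
    rewrite inE; apply/forall_inP => i nil.
    have [z] := Ht i; rewrite !inE => /orP[/eqP ->|zY].
      apply: ltn_trans; by move/forall_inP: xA; apply.
    by apply: leq_ltn_trans; apply: (mP i).2.
  have [z] := Ht l; rewrite !inE => /orP[/eqP ->|zY].
    by rewrite ltnNge xmax.
  rewrite ltnNge (leq_trans (xmax _ tA)) // ltnW // (leq_trans (Alt _ _ lp xA)) //.
  exact: (mP l).2.
have jp : j \in [set j; k] by rewrite !inE eqxx.
have kp : k \in [set j; k] by rewrite !inE eqxx orbT.
suff -> : [set z | (z \notin Y) && dominant (z |: Y)] = [set x j; x k].
  rewrite cards2; suff -> : x j != x k by [].
  apply/eqP => e; have /forall_inP/(_ k) := (xP j).1.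
  rewrite eq_sym njk e => /(_ isT).
  by have := Alt k _ kp (xP k).1; lia.
apply/setP => z; rewrite inE in_set2; apply/andP/orP; last first.
  by case=> /eqP ->; split; [exact: AY jp (xP j).1 | exact: xdom
                            |exact: AY kp (xP k).1 | exact: xdom].
move=> [zY domz].
have [l Hl] : exists l, forall z', z' \in z |: Y -> rank l z <= rank l z'.
  by apply: dominant_min => //; rewrite !inE eqxx.
pose m' i := [arg min_(v < z in z |: Y) rank i v].
have zzY : z \in z |: Y by rewrite !inE eqxx.
have m'P i : m' i \in z |: Y /\ forall v, v \in z |: Y -> rank i (m' i) <= rank i v.
  by rewrite /m'; case: arg_minnP.
have m'E i v : v \in z |: Y -> (forall z', z' \in z |: Y -> rank i v <= rank i z') -> m' i = v.
  move=> vY vmin; apply: (@rank_inj i); apply/eqP.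
  by rewrite eqn_leq vmin ?(m'P i).2 ?(m'P i).1.
(* The minima of the enlarged set are onto a set as large as [I]. Away from the order [l] taken over
   by [z] they agree with [m], so the collision of [j] and [k] forces [l] to be one of these two. *)
have m'inj : injective m'.
  move=> a b; suff /imset_injP h : #|m' @: setT| == #|[set: I]| by apply: h; rewrite inE.
  have -> : m' @: setT = z |: Y.
    apply/setP => v; apply/imsetP/idP => [[i _ ->]|vY]; first exact: (m'P i).1.
    by have [i Hi] := dominant_min domz vY; exists i; rewrite ?inE ?(m'E i v).
  by rewrite cardsT cardsU1 zY cY.
have m'l : m' l = z by apply: m'E.
have m'm i : i != l -> m' i = m i.
  move=> nil; apply/esym/mE => [|v vY]; last by apply: (m'P i).2; rewrite !inE vY orbT.
  have := (m'P i).1; rewrite !inE => /orP[/eqP e|//].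
  by move: nil; rewrite (m'inj i l) ?eqxx // e m'l.
have zA : z \in A l.
  rewrite inE; apply/forall_inP => i nil.
  rewrite ltn_neqAle -m'm // (m'P i).2 // andbT.
  apply/eqP => /(@rank_inj i) e; move: nil.
  by rewrite (m'inj i l) ?eqxx // e m'l.
have lp : l \in [set j; k].
  apply: contraT; rewrite !inE negb_or ![l == _]eq_sym => /andP[njl nkl].
  by move: njk; rewrite (m'inj j k) ?eqxx // !m'm.
(* If [z] were smaller than [x l] in the order [l], then [x l] would exceed some member of [z |: Y]
   in every order. *)
have zx : z = x l.
  have [xA xmax] := xP l; apply/eqP; apply: contraT => nzx.
  have lt : rank l z < rank l (x l).
    by rewrite ltn_neqAle xmax // andbT; apply: contra nzx => /eqP/(@rank_inj l) ->.
  case ex : (x l) => [q|t].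
    have [e|nql] := eqVneq q l; first by move: lt; rewrite ex e /= eqxx.
    by move: xA; rewrite ex inE => /forall_inP/(_ q nql); rewrite /= eqxx.
  suff : ~~ dominant (z |: Y) by rewrite domz.
  apply: (@dominantPn _ t) => i; have [->|nil] := eqVneq i l.
    by exists z; rewrite // -ex.
  exists (m i); first by rewrite !inE (mP i).1 orbT.
  by move: xA; rewrite ex inE => /forall_inP; apply.
by move: lp; rewrite !inE zx => /orP[]/eqP ->; rewrite eqxx; [left|right].
Qed.

Lemma outer_door (Y : {set V}) : colour @: Y = ~: [set i0] ->
  (forall t, inr t \notin Y) -> Y = (@inl I T) @: (~: [set i0]).
Proof.
move=> <- noT; apply/setP => -[j|t]; last first.
  by rewrite (negbTE (noT t)); apply/esym/negP => /imsetP[].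
rewrite mem_imset => [|? ? []//]; apply/idP/imsetP => [jY|[[j' jY ->//|t tY]]].
  by exists (inl j).
by have := noT t; rewrite tY.
Qed.

(** Both sides count incident pairs of a room and a door, through [Y = Z :\ z]; dominance of [Y] is
    inherited from [Z]. *)
Lemma count_doors_of_rooms :
  \sum_(Z : {set V} | (#|Z| == #|I|) && dominant Z)
     #|[set z in Z | colour @: (Z :\ z) == ~: [set i0]]| =
  \sum_(Y : {set V} | [&& #|I| == #|Y|.+1, dominant Y & colour @: Y == ~: [set i0]])
     #|[set z | (z \notin Y) && dominant (z |: Y)]|.
Proof.
under eq_bigr do rewrite -sum1dep_card.
rewrite pair_big_dep /=.
under [RHS]eq_bigr do rewrite -sum1dep_card.
rewrite [RHS]pair_big_dep /=.
rewrite (reindex_onto (fun p : {set V} * V => (p.2 |: p.1, p.2))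
                      (fun p => (p.1 :\ p.2, p.2))) /=; last first.
  by move=> [Z z] /= /andP[_ /andP[zZ _]]; rewrite setD1K.
apply: eq_bigl => -[Y z] /=; rewrite !inE eqxx /=.
have [zY|zY] := boolP (z \in Y).
  rewrite andbF /=; apply/negP => /andP[_ /eqP[]] => e.
  by move: zY; rewrite -e !inE eqxx.
rewrite setU1K // eqxx andbT cardsU1 zY add1n [_ == #|I|]eq_sym /=.
have [dz|] := boolP (dominant (z |: Y)); last by rewrite !andbF.
by rewrite (dominantS _ dz) ?subsetUr //= !andbT.
Qed.

(** Parity: without a fully coloured room every room has an even number of doors, while every door
    bounds two rooms except the outer one, which bounds a single room. *)
Theorem colourful_room : exists Z : {set V},
  [/\ #|Z| = #|I|, dominant Z & colour @: Z = setT].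
Proof.
suff /existsP[Z /and3P[/eqP ? ? /eqP ?]] : [exists Z : {set V},
    [&& #|Z| == #|I|, dominant Z & colour @: Z == setT]] by exists Z.
apply: contraT; rewrite negb_exists => /forallP none.
have even_rooms : ~~ odd (\sum_(Z : {set V} | (#|Z| == #|I|) && dominant Z)
     #|[set z in Z | colour @: (Z :\ z) == ~: [set i0]]|).
  apply: (big_ind (fun n => ~~ odd n)) => // [a b|Z /andP[/eqP cZ dZ]].
    by rewrite oddD => /negbTE -> /negbTE ->.
  by rewrite odd_doors_of_room //; have := none Z; rewrite cZ eqxx dZ.
pose Y0 : {set V} := (@inl I T) @: (~: [set i0]).
have imY0 : colour @: Y0 = ~: [set i0].
  by rewrite -imset_comp -[RHS]imset_id; apply: eq_imset.
move: even_rooms; rewrite count_doors_of_rooms (bigD1 Y0) /=; last first.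
  rewrite imY0 eqxx andbT card_imset; last by move=> ? ? [].
  rewrite cardsC1 prednK ?eqxx /=; last by apply/card_gt0P; exists i0.
  apply/dominantP => t; exists i0 => z /imsetP[j]; rewrite !inE => nj ->.
  exact/ltnW/rank_inr_lt.
rewrite (rooms_of_outer_door (erefl _)) add1n oddS negbK.
apply: contraTT => _; apply: (big_ind (fun n => ~~ odd n)) => // [a b|Y].
  by rewrite oddD => /negbTE -> /negbTE ->.
move=> /andP[/and3P[/eqP cY dY /eqP imY] nY].
have [/existsP[t tY]|] := boolP [exists t, inr t \in Y].
  by rewrite (rooms_of_inner_door tY).
by rewrite negb_exists => /forallP noT; case/eqP: nY; apply: outer_door.
Qed.

End Rooms.

(** * Clusters of labelled grid points in the simplex *)

Section Grid.

Variables (n k : nat).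

Definition grid := {x : {ffun 'I_n.+1 -> 'I_k.+1} | \sum_i (x i : nat) == k}.

Definition gval (x : grid) (i : 'I_n.+1) : nat := val x i.

Lemma gval_sum (x : grid) : \sum_i gval x i = k.
Proof. exact/eqP/(valP x). Qed.

Lemma grid_of (g : 'I_n.+1 -> nat) : \sum_i g i = k -> exists x : grid, gval x =1 g.
Proof.
move=> sg.
have gk i : g i < k.+1 by rewrite ltnS -sg (bigD1 i) //= leq_addr.
pose x : {ffun 'I_n.+1 -> 'I_k.+1} := [ffun i => inord (g i)].
have xE i : x i = g i :> nat by rewrite ffunE inordK.
have xP : \sum_i (x i : nat) == k by rewrite -[X in _ == X]sg; apply/eqP/eq_bigr.
by exists (exist _ x xP) => i; rewrite /gval xE.
Qed.

(** The i-th coordinate with ties broken lexicographically by the enumeration, since the orders of a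
    room must be injective. *)
Definition grank (i : 'I_n.+1) (x : grid) : nat := gval x i * #|{: grid}| + enum_rank x.

Lemma grank_inj i : injective (grank i).
Proof.
move=> x y e; apply/enum_rank_inj/val_inj => /=.
by have := congr1 (modn^~ #|{: grid}|) e; rewrite /grank /= !modnMDl !modn_small.
Qed.

Lemma grank_le i x y : grank i x <= grank i y -> gval x i <= gval y i.
Proof.
rewrite leqNgt => h; rewrite leqNgt; apply: contra h => h; rewrite /grank.
apply: (@leq_trans ((gval y i).+1 * #|{: grid}|)).
  by rewrite mulSn addnC ltn_add2r ltn_ord.
by apply: leq_trans (leq_addr _ _); rewrite leq_mul2r h orbT.
Qed.

(** The coordinatewise minima [m] of a dominant set add up to more than k - (n + 1), otherwise some
    grid point would exceed them all. Members of the set add up to k and lie above [m], so they stay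
    within n + 1 of it. In a colourful room the colour [i] belongs to a grid point or to the slack
    [i], and in the latter case the coordinate [i] is small. *)
Lemma colourful_cluster (c : grid -> 'I_n.+1) :
  exists w : grid, forall i, gval w i <= n.+1 \/
    exists w' : grid, c w' = i /\ forall j, gval w j <= gval w' j + n.+1 <= gval w j + n.+1 + n.+1.
Proof.
have [t0 _] : exists x : grid, gval x =1 fun i => if i == ord0 then k else 0.
  by apply: grid_of; rewrite -big_mkcond /= big_pred1_eq.
have [Z [cZ dZ imZ]] := @colourful_room _ _ ord0 t0 _ c grank_inj.
have domZ (y : grid) : exists2 i, inl i \notin Z &
    forall x, inr x \in Z -> gval y i <= gval x i.
  have /dominantP/(_ y)[i Hi] := dZ; exists i; last first.
    by move=> x /Hi h; apply: grank_le.
  by apply/negP => /Hi; rewrite /= eqxx.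
have [w wZ] : exists w, inr w \in Z.
  apply/existsP; apply: contraT; rewrite negb_exists => /forallP noT.
  have [i /negP[]] := domZ t0.
  have : i \in colour c @: Z by rewrite imZ inE.
  by case/imsetP => -[j jZ ->//|t tZ]; have := noT t; rewrite tZ.
(* A slack stands for the face where its coordinate vanishes, hence the value 0. *)
pose m i := if inl i \in Z then 0 else gval [arg min_(x < w | inr x \in Z) gval x i] i.
have mP i x : inr x \in Z -> m i <= gval x i.
  by rewrite /m; case: ifP => // _; case: arg_minnP => // y yZ + xZ; apply.
have m_sum : k < \sum_i m i + n.+1.
  rewrite ltnNge; apply/negP => le.
  (* The forbidden grid point: one more than the minimum wherever [i] could witness dominance, and
     the remaining mass put on [ord0]. *)
  pose g i := m i + (inl i \notin Z) + (if i == ord0 then k - \sum_i (m i + (inl i \notin Z)) else 0).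
  have le1 : \sum_i (m i + (inl i \notin Z)) <= k.
    apply: leq_trans le; rewrite big_split /= leq_add2l.
    by rewrite -[X in _ <= X]card_ord -sum1_card; apply: leq_sum => i _; case: (_ \notin _).
  have [|y yE] := @grid_of g.
    by rewrite big_split /= -big_mkcond /= big_pred1_eq subnKC.
  have [i iZ Hi] := domZ y.
  have [x xZ mx] : exists2 x, inr x \in Z & m i = gval x i.
    by rewrite /m (negbTE iZ); case: (@arg_minnP _ w (fun x => inr x \in Z) (fun x => gval x i) wZ) => x xZ _; exists x.
  by have := Hi x xZ; rewrite yE /g iZ mx; lia.
have near x : inr x \in Z -> forall j, m j <= gval x j <= m j + n.+1.
  move=> xZ j; rewrite mP //=.
  have := gval_sum x; have := m_sum; rewrite (bigD1 j) //= [X in X = k -> _](bigD1 j) //=.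
  have : \sum_(i | i != j) m i <= \sum_(i | i != j) gval x i by apply: leq_sum => i _; apply: mP.
  by move: (\sum_(i | i != j) m i) (\sum_(i | i != j) gval x i) => a b; lia.
exists w => i; have := near _ wZ; have [iZ|iZ] := boolP (inl i \in Z).
  by left; have := near _ wZ i; rewrite /m iZ; lia.
right; have : i \in colour c @: Z by rewrite imZ inE.
case/imsetP => -[j jZ /= e|w' wZ' ->]; first by rewrite e jZ in iZ.
by exists w'; split => // j; have := near _ wZ j; have := near _ wZ' j; lia.
Qed.

End Grid.

(* A labelled form of Brouwer's theorem on the simplex, scaled by k. *)
Theorem label_cluster (n k : nat) (good : (nat -> nat) -> nat -> Prop) :
  (forall w : nat -> nat, \sum_(i < n.+1) w i = k -> exists2 i, i <= n & good w i) ->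
  exists2 w : nat -> nat, \sum_(i < n.+1) w i = k & forall i, i <= n ->
    w i <= n.+1 \/ exists w' : nat -> nat, [/\ \sum_(i < n.+1) w' i = k, good w' i &
      forall j, j <= n -> w j <= w' j + n.+1 <= w j + n.+1 + n.+1].
Proof.
move=> H; pose g (x : grid n k) := fun i => gval x (inord i).
have gs (x : grid n k) : \sum_(i < n.+1) g x i = k.
  by rewrite -[RHS](gval_sum x); apply: eq_bigr => i _; rewrite /g inord_val.
have [c cP] : exists c : grid n k -> 'I_n.+1, forall x, good (g x) (c x).
  apply: (@fin_all_exists _ _ (fun x (i : 'I_n.+1) => good (g x) i)) => x; have [i le gi] := H _ (gs x).
  by exists (inord i); rewrite inordK.
have [w wP] := colourful_cluster c; exists (g w) => // i le.
have [|[w' [cw' near]]] := wP (inord i); [by left|right].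
exists (g w'); split=> // [|j _]; last exact: near.
by have := cP w'; rewrite cw' inordK.
Qed.

End Scarf.

(** * Passage to real points of the standard simplex *)

Module Simplex.
Import all_boot.

Lemma INR_sum (w : nat -> nat) (n : nat) :
  INR (\sum_(i < n.+1) w i)%N = sum_f_R0 (fun i => INR (w i)) n.
Proof.
elim: n => [|n IH]; first by rewrite big_ord_recr big_ord0.
by rewrite big_ord_recr /= plus_INR IH.
Qed.

(** The alternative of a small coordinate stands in for the boundary condition of Sperner's lemma:
    labels on the faces are unrestricted. *)
Theorem simplex_cluster (n k : nat) (good : (nat -> R) -> nat -> Prop) :
  (0 < k)%coq_nat ->
  (forall p, (forall i, 0 <= p i) -> sum_f_R0 p n = 1 -> exists i, (i <= n)%coq_nat /\ good p i) ->
  exists p, (forall i, 0 <= p i) /\ sum_f_R0 p n = 1 /\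
    forall i, (i <= n)%coq_nat -> p i <= INR (S n) / INR k \/
      exists q, (forall j, 0 <= q j) /\ sum_f_R0 q n = 1 /\ good q i /\
        forall j, (j <= n)%coq_nat -> Rabs (q j - p j) <= INR (S n) / INR k.
Proof.
move=> k0 H; have k0R : 0 < INR k by exact: lt_0_INR.
pose sc (w : nat -> nat) := fun i => INR (w i) / INR k.
have sc0 w i : 0 <= sc w i.
  by apply: Rmult_le_pos; [exact: pos_INR | apply/Rlt_le/Rinv_0_lt_compat].
have sc1 (w : nat -> nat) : (\sum_(i < n.+1) w i)%N = k -> sum_f_R0 (sc w) n = 1.
  move=> sw; have := INR_sum w n; rewrite sw /sc => e.
  rewrite -(scal_sum (fun i => INR (w i)) n (/ INR k)) -e; field; lra.
have scle (a b : nat) : (a <= b)%N -> INR a / INR k <= INR b / INR k.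
  move=> /leP/le_INR ab; apply: Rmult_le_compat_r => //.
  by apply/Rlt_le/Rinv_0_lt_compat.
have [|w sw wP] := @Scarf.label_cluster n k (fun w => good (sc w)).
  move=> w sw; have [i [le gi]] := H (sc w) (sc0 w) (sc1 w sw).
  by exists i => //; apply/leP.
exists (sc w); split; first exact: sc0.
split; first exact: sc1.
move=> i /leP le; have [le1|[w' [sw' gw' near]]] := wP i le; [left|right].
  exact: scle.
exists (sc w'); split; first exact: sc0.
split; first exact: sc1.
split=> // j /leP lj; have /andP[/leP/le_INR + /leP/le_INR] := near j lj.
rewrite !plus_INR => h1 h2; have kV := Rinv_0_lt_compat _ k0R.
rewrite /sc /Rdiv.
have -> : INR (w' j) * / INR k - INR (w j) * / INR k = (INR (w' j) - INR (w j)) * / INR k by ring.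
rewrite Rabs_mult (Rabs_pos_eq (/ INR k)); last lra.
by apply: Rmult_le_compat_r; [lra | apply: Rabs_le; lra].
Qed.
End Simplex.

(** * A uniform cluster point of equi-Lipschitz functions *)

Definition clamp (a b t : R) : R := Rmax a (Rmin b t).

Lemma clamp_in a b t : a <= b -> a <= clamp a b t <= b.
Proof.
  intros H; unfold clamp; split; [apply Rmax_l|].
  apply Rmax_lub; [exact H | apply Rmin_l].
Qed.

Lemma clamp_id a b t : a <= t <= b -> clamp a b t = t.
Proof.
  intros H; unfold clamp; rewrite Rmin_right, Rmax_right; lra.
Qed.

Lemma clamp_lip a b s t : Rabs (clamp a b s - clamp a b t) <= Rabs (s - t).
Proof.
  unfold clamp, Rmax, Rmin.
  repeat destruct Rle_dec; unfold Rabs; repeat destruct Rcase_abs; lra.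
Qed.

Definition lipschitz (L : R) (y : R -> R) : Prop :=
  forall s t, Rabs (y s - y t) <= L * Rabs (s - t).

Lemma continuous_eps (y : R -> R) t :
  (forall eps, 0 < eps -> exists delta, 0 < delta /\
     forall s, Rabs (s - t) < delta -> Rabs (y s - y t) < eps) <->
  continuous y t.
Proof.
  split; intros H.
  - apply continuity_pt_filterlim, continuity_pt_locally; intros eps.
    destruct (H eps (cond_pos eps)) as [d [d0 Hd]].
    exists (mkposreal d d0); intros s Hs; apply Hd, Hs.
  - apply continuity_pt_filterlim in H; rewrite continuity_pt_locally in H.
    intros eps e0; destruct (H (mkposreal eps e0)) as [d Hd].
    exists d; split; [apply cond_pos|]; intros s Hs; apply Hd, Hs.
Qed.

Lemma lipschitz_continuous L y : lipschitz L y -> forall t, continuous y t.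
Proof.
  intros H t; apply continuous_eps; intros eps e0.
  assert (HL : 0 < Rabs L + 1) by (pose proof (Rabs_pos L); lra).
  exists (eps / (Rabs L + 1)); split; [apply Rdiv_lt_0_compat; lra|].
  intros s Hs; apply Rle_lt_trans with ((Rabs L + 1) * Rabs (s - t)).
  - eapply Rle_trans; [apply H|]; apply Rmult_le_compat_r; [apply Rabs_pos|].
    pose proof (Rle_abs L); lra.
  - apply Rmult_lt_reg_r with (/ (Rabs L + 1)); [apply Rinv_0_lt_compat, HL|].
    replace ((Rabs L + 1) * Rabs (s - t) * / (Rabs L + 1)) with (Rabs (s - t)) by (field; lra).
    exact Hs.
Qed.

(** Subsequences are encoded as infinite sets of indices, so that repeated extraction is mere
    inclusion. *)
Definition infinitely (P : nat -> Prop) : Prop := forall N, exists n, (N <= n)%nat /\ P n.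

Lemma infinitely_small_range (v : nat -> R) (eps : R) (K : nat) :
  0 < eps -> forall (a : R) (P : nat -> Prop), infinitely P ->
  (forall n, P n -> a <= v n <= a + INR K * eps) ->
  exists Q, infinitely Q /\ (forall n, Q n -> P n) /\
    forall n m, Q n -> Q m -> Rabs (v n - v m) <= eps.
Proof.
  intros e0; induction K as [|K IH]; intros a P HP Hv.
  - exists P; split; [exact HP|split; [tauto|]]; intros n m Hn Hm.
    pose proof (Hv n Hn); pose proof (Hv m Hm); simpl in *; apply Rabs_le; lra.
  - destruct (classic (infinitely (fun n => P n /\ v n <= a + eps))) as [H|H].
    + exists (fun n => P n /\ v n <= a + eps); split; [exact H|split; [tauto|]].
      intros n m [Hn Hn'] [Hm Hm']; pose proof (Hv n Hn); pose proof (Hv m Hm).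
      apply Rabs_le; lra.
    + destruct (not_all_ex_not _ _ H) as [N HN].
      destruct (IH (a + eps) (fun n => P n /\ (N <= n)%nat)) as [Q [HQ [HQP HQv]]].
      * intros M; destruct (HP (Nat.max N M)) as [n [Hn Pn]].
        exists n; repeat split; [lia|exact Pn|lia].
      * intros n [Pn Hn]; pose proof (Hv n Pn) as Hvn; rewrite S_INR in Hvn.
        assert (a + eps < v n); [|lra].
        apply Rnot_le_lt; intros Hle; apply HN; exists n; auto.
      * exists Q; split; [exact HQ|split; [firstorder|exact HQv]].
Qed.

Lemma infinitely_small_ranges (u : nat -> nat -> R) (B eps : R) (K : nat) :
  0 < eps -> (forall i n, Rabs (u i n) <= B) ->
  forall P : nat -> Prop, infinitely P ->
  exists Q, infinitely Q /\ (forall n, Q n -> P n) /\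
    forall i, (i <= K)%nat -> forall n m, Q n -> Q m -> Rabs (u i n - u i m) <= eps.
Proof.
  intros e0 HB P HP.
  assert (step : forall i (P : nat -> Prop), infinitely P ->
    exists Q, infinitely Q /\ (forall n, Q n -> P n) /\
      forall n m, Q n -> Q m -> Rabs (u i n - u i m) <= eps).
  { clear P HP; intros i P HP.
    destruct (INR_unbounded (2 * B / eps)) as [M HM].
    apply infinitely_small_range with (a := - B) (K := M); [exact e0|exact HP|].
    intros n _; pose proof (HB i n) as H; apply Rabs_le_between in H.
    assert (2 * B <= INR M * eps); [|lra].
    apply Rmult_le_reg_r with (/ eps); [apply Rinv_0_lt_compat, e0|].
    replace (INR M * eps * / eps) with (INR M) by (field; lra); unfold Rdiv in HM; lra. }
  induction K as [|K [Q [HQ [HQP HQu]]]].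
  - destruct (step O P HP) as [Q [HQ [HQP HQu]]].
    exists Q; split; [exact HQ|split; [exact HQP|]].
    intros i Hi; replace i with O by lia; exact HQu.
  - destruct (step (S K) Q HQ) as [Q' [HQ' [HQP' HQu']]].
    exists Q'; split; [exact HQ'|split; [auto|]].
    intros i Hi n m Hn Hm; destruct (Nat.eq_dec i (S K)) as [->|ne]; [auto|].
    apply HQu; auto; lia.
Qed.

Lemma infinitely_uniformly_close (u : nat -> R -> R) (B L eps : R) (P : nat -> Prop) :
  0 < eps -> 0 <= L -> (forall n t, Rabs (u n t) <= B) -> (forall n, lipschitz L (u n)) ->
  infinitely P ->
  exists Q, infinitely Q /\ (forall n, Q n -> P n) /\
    forall n m, Q n -> Q m -> forall t, 0 <= t <= 1 -> Rabs (u n t - u m t) <= eps.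
Proof.
  intros e0 L0 HB HL HP.
  (* The mesh makes each function vary by at most eps / 4 up to the nearby node; the nodes
     themselves use eps / 2. *)
  destruct (INR_unbounded (4 * L / eps)) as [K HK].
  destruct (infinitely_small_ranges (fun i n => u n (INR i / INR (S K))) B (eps / 2) (S K))
    with (P := P) as [Q [HQ [HQP HQu]]]; [lra|auto|exact HP|].
  exists Q; split; [exact HQ|split; [exact HQP|]]; intros n m Hn Hm t Ht.
  assert (K0 : 0 < INR (S K)) by (apply lt_0_INR; lia).
  assert (exists i, (i <= S K)%nat /\ Rabs (t - INR i / INR (S K)) <= / INR (S K)) as [i [Hi Hti]].
  { destruct (nfloor_ex (t * INR (S K))) as [i Hi]; [nra|].
    exists i; split.
    - apply INR_le; nra.
    - replace (t - INR i / INR (S K)) with ((t * INR (S K) - INR i) * / INR (S K)) by (field; lra).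
      rewrite Rabs_mult, (Rabs_pos_eq (/ INR (S K))) by (left; apply Rinv_0_lt_compat, K0).
      rewrite <- (Rmult_1_l (/ INR (S K))) at 2.
      apply Rmult_le_compat_r; [left; apply Rinv_0_lt_compat, K0|]; apply Rabs_le; lra. }
  assert (HLK : L * / INR (S K) <= eps / 4).
  { apply Rmult_le_reg_r with (INR (S K)); [exact K0|].
    replace (L * / INR (S K) * INR (S K)) with L by (field; lra).
    apply Rmult_lt_compat_r with (r := eps) in HK; [|exact e0].
    replace (4 * L / eps * eps) with (4 * L) in HK by (field; lra).
    rewrite S_INR; nra. }
  pose proof (HQu i Hi n m Hn Hm) as H1; cbv beta in H1.
  pose proof (HL n t (INR i / INR (S K))) as H2.
  pose proof (HL m t (INR i / INR (S K))) as H3.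
  assert (H4 : L * Rabs (t - INR i / INR (S K)) <= eps / 4).
  { eapply Rle_trans; [apply Rmult_le_compat_l; [exact L0|exact Hti]|exact HLK]. }
  apply Rabs_le_between in H1; apply Rabs_le.
  pose proof (Rle_trans _ _ _ H2 H4) as H5; apply Rabs_le_between in H5.
  pose proof (Rle_trans _ _ _ H3 H4) as H6; apply Rabs_le_between in H6; lra.
Qed.

(* Arzela-Ascoli, in the form of a uniform cluster point. *)
Theorem equilipschitz_cluster (u : nat -> R -> R) (B L : R) :
  0 <= L -> (forall n t, Rabs (u n t) <= B) -> (forall n, lipschitz L (u n)) ->
  exists y, lipschitz L y /\ (forall t, Rabs (y t) <= B) /\
    forall eps N, 0 < eps -> exists n, (N <= n)%nat /\
      forall t, 0 <= t <= 1 -> Rabs (u n t - y t) <= eps.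
Proof.
  intros L0 HB HL.
  pose (good := fun (k : nat) (P Q : nat -> Prop) => infinitely Q /\ (forall n, Q n -> P n) /\
    forall n m, Q n -> Q m -> forall t, 0 <= t <= 1 -> Rabs (u n t - u m t) <= / INR (S k)).
  assert (step : forall k (P : {P | infinitely P}), {Q | good k (proj1_sig P) Q}).
  { intros k [P HP]; apply constructive_indefinite_description.
    apply (infinitely_uniformly_close u B L); auto.
    apply Rinv_0_lt_compat, lt_0_INR; lia. }
  assert (H0 : infinitely (fun _ => True)) by (intros N; exists N; split; auto).
  (* Nested infinite index sets; on [Ps (S k)] the functions differ by at most 1 / (k + 1). *)
  pose (Ps := fix Ps k : {P | infinitely P} := match k with
     | O => exist _ (fun _ => True) H0
     | S k => exist _ (proj1_sig (step k (Ps k))) (proj1 (proj2_sig (step k (Ps k))))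
     end).
  assert (mono : forall j k, (j <= k)%nat -> forall n, proj1_sig (Ps k) n -> proj1_sig (Ps j) n).
  { intros j k Hjk; induction Hjk as [|k Hjk IH]; [auto|]; intros n Hn; apply IH.
    apply (proj2_sig (step k (Ps k))); exact Hn. }
  assert (close : forall k n m, proj1_sig (Ps (S k)) n -> proj1_sig (Ps (S k)) m ->
     forall t, 0 <= t <= 1 -> Rabs (u n t - u m t) <= / INR (S k)).
  { intros k; apply (proj2_sig (step k (Ps k))). }
  assert (pick : forall k, {n | (k <= n)%nat /\ proj1_sig (Ps (S k)) n}).
  { intros k; apply constructive_indefinite_description, (proj2_sig (Ps (S k))). }
  (* The diagonal choice. It need not be increasing: [k <= phi k] and membership in all earlier sets
     suffice. *)
  pose (phi := fun k => proj1_sig (pick k)).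
  assert (phi_ge : forall k, (k <= phi k)%nat) by (intros k; apply (proj2_sig (pick k))).
  assert (phiP : forall j k, (j <= k)%nat -> proj1_sig (Ps (S j)) (phi k)).
  { intros j k Hjk; apply mono with (S k); [lia|]; apply (proj2_sig (pick k)). }
  assert (small : forall eps, 0 < eps -> exists k, forall j, (k <= j)%nat -> / INR (S j) <= eps).
  { intros eps e0; destruct (INR_unbounded (/ eps)) as [k Hk]; exists k; intros j Hj.
    rewrite <- (Rinv_inv eps); apply Rinv_le_contravar; [apply Rinv_0_lt_compat, e0|].
    apply le_INR in Hj; rewrite S_INR; lra. }
  assert (cl01 : forall t, 0 <= clamp 0 1 t <= 1) by (intros t; apply clamp_in; lra).
  assert (cau : forall t, ex_finite_lim_seq (fun k => u (phi k) (clamp 0 1 t))).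
  { intros t; apply ex_lim_seq_cauchy_corr; intros eps.
    destruct (small (eps / 2)) as [k Hk]; [pose proof (cond_pos eps); lra|].
    exists k; intros n m Hn Hm; apply Rle_lt_trans with (/ INR (S k)).
    - apply close; [apply phiP, Hn|apply phiP, Hm|apply cl01].
    - specialize (Hk k (Nat.le_refl k)); pose proof (cond_pos eps); lra. }
  (* Convergence is known on [0,1] only; clamping the argument makes the limit Lipschitz on the
     whole line. *)
  pose (y := fun t => real (Lim_seq (fun k => u (phi k) (clamp 0 1 t)))).
  assert (lim : forall t, is_lim_seq (fun k => u (phi k) (clamp 0 1 t)) (y t)).
  { intros t; apply Lim_seq_correct', cau. }
  exists y; split; [|split].
  - intros s t.
    apply (is_lim_seq_le (fun k => Rabs (u (phi k) (clamp 0 1 s) - u (phi k) (clamp 0 1 t)))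
      (fun _ => L * Rabs (s - t)) (Rabs (y s - y t)) (L * Rabs (s - t))).
    + intros k; eapply Rle_trans; [apply HL|].
      apply Rmult_le_compat_l; [exact L0|apply clamp_lip].
    + apply (is_lim_seq_abs _ (y s - y t)), is_lim_seq_minus'; apply lim.
    + apply is_lim_seq_const.
  - intros t.
    apply (is_lim_seq_le (fun k => Rabs (u (phi k) (clamp 0 1 t))) (fun _ => B) (Rabs (y t)) B).
    + intros k; apply HB.
    + apply (is_lim_seq_abs _ (y t)), lim.
    + apply is_lim_seq_const.
  - intros eps N e0; destruct (small eps e0) as [k Hk].
    exists (phi (Nat.max k N)); split; [pose proof (phi_ge (Nat.max k N)); lia|].
    intros t Ht; apply Rle_trans with (/ INR (S (Nat.max k N))); [|apply Hk; lia].
    pose proof (lim t) as Hl; rewrite (clamp_id 0 1 t) in Hl by exact Ht.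
    apply (is_lim_seq_le_loc (fun j => Rabs (u (phi (Nat.max k N)) t - u (phi j) t))
      (fun _ => / INR (S (Nat.max k N))) (Rabs (u (phi (Nat.max k N)) t - y t)) (/ INR (S (Nat.max k N)))).
    + exists (Nat.max k N); intros j Hj; apply close; [apply phiP; lia|apply phiP, Hj|exact Ht].
    + apply (is_lim_seq_abs _ (u (phi (Nat.max k N)) t - y t)), is_lim_seq_minus'; [apply is_lim_seq_const|exact Hl].
    + apply is_lim_seq_const.
Qed.

(** * Eigenfunctions of kernel operators *)

Lemma ex_RInt_cont (f : R -> R) a b : (forall t, continuous f t) -> ex_RInt f a b.
Proof. intros H; apply (@ex_RInt_continuous R_CompleteNormedModule); auto. Qed.

Lemma RInt_close (f g h : R -> R) a b : a <= b ->
  (forall t, continuous f t) -> (forall t, continuous g t) -> (forall t, continuous h t) ->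
  (forall t, a <= t <= b -> Rabs (f t - g t) <= h t) ->
  Rabs (RInt f a b - RInt g a b) <= RInt h a b.
Proof.
  intros ab cf cg ch H.
  assert (cfg : forall t, continuous (fun s => f s - g s) t)
    by (intros t; apply (continuous_minus f g); auto).
  replace (RInt f a b - RInt g a b) with (RInt (fun t => f t - g t) a b).
  - eapply Rle_trans; [apply abs_RInt_le; [exact ab|apply ex_RInt_cont, cfg]|].
    apply RInt_le; [exact ab| |apply ex_RInt_cont, ch|intros t Ht; apply H; lra].
    apply ex_RInt_cont; intros t; apply (continuous_comp (fun s => f s - g s) Rabs);
      [apply cfg|apply continuous_Rabs].
  - apply (RInt_minus f g); apply ex_RInt_cont; auto.
Qed.

Lemma RInt_close_const (f g : R -> R) eps a b : a <= b ->
  (forall t, continuous f t) -> (forall t, continuous g t) ->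
  (forall t, a <= t <= b -> Rabs (f t - g t) <= eps) ->
  Rabs (RInt f a b - RInt g a b) <= eps * (b - a).
Proof.
  intros ab cf cg H.
  replace (eps * (b - a)) with (RInt (fun _ => eps) a b).
  - apply RInt_close; auto; intros t; apply continuous_const.
  - rewrite RInt_const; apply Rmult_comm.
Qed.

Lemma sum_abs_le (a b : nat -> R) n :
  (forall i, (i <= n)%nat -> Rabs (a i) <= b i) -> Rabs (sum_f_R0 a n) <= sum_f_R0 b n.
Proof.
  intros H; eapply Rle_trans; [apply Rsum_abs|]; apply sum_Rle; exact H.
Qed.

Lemma RInt_cells (b : R -> R) n : (forall t, continuous b t) ->
  sum_f_R0 (fun i => RInt b (INR i / INR (S n)) (INR (S i) / INR (S n))) n = RInt b 0 1.
Proof.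
  intros cb.
  assert (H : forall m, sum_f_R0 (fun i => RInt b (INR i / INR (S n)) (INR (S i) / INR (S n))) m
    = RInt b 0 (INR (S m) / INR (S n))).
  { induction m as [|m IH].
    - simpl sum_f_R0; f_equal; unfold Rdiv; simpl INR; ring.
    - rewrite tech5, IH; apply (RInt_Chasles b); apply ex_RInt_cont, cb. }
  rewrite H; f_equal; field; apply not_0_INR; lia.
Qed.

Definition atoms (G : R -> R -> R) (n : nat) (p : nat -> R) (t : R) : R :=
  sum_f_R0 (fun i => p i * G t (INR i / INR (S n))) n.

Section Atoms.

Variables (G : R -> R -> R) (B L mu : R) (n : nat) (p : nat -> R).
Hypothesis p0 : forall i, 0 <= p i.
Hypothesis p1 : sum_f_R0 p n = 1.

Lemma atoms_bound t : (forall t s, Rabs (G t s) <= B) -> Rabs (atoms G n p t) <= B.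
Proof.
  intros GB; replace B with (sum_f_R0 (fun i => p i * B) n)
    by (rewrite <- scal_sum, p1; ring).
  apply sum_abs_le; intros i _; rewrite Rabs_mult, (Rabs_pos_eq (p i)) by apply p0.
  apply Rmult_le_compat_l; [apply p0|apply GB].
Qed.

Lemma atoms_lipschitz : (forall s, lipschitz L (fun t => G t s)) -> lipschitz L (atoms G n p).
Proof.
  intros GL t t'; unfold atoms; rewrite <- minus_sum.
  replace (L * Rabs (t - t')) with (sum_f_R0 (fun i => p i * (L * Rabs (t - t'))) n)
    by (rewrite <- scal_sum, p1; ring).
  apply sum_abs_le; intros i _.
  rewrite <- Rmult_minus_distr_l, Rabs_mult, (Rabs_pos_eq (p i)) by apply p0.
  apply Rmult_le_compat_l; [apply p0|apply GL].
Qed.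

Lemma atoms_integral : (forall s, lipschitz L (fun t => G t s)) ->
  (forall s, 0 <= s <= 1 -> RInt (fun t => G t s) 0 1 = mu) ->
  RInt (atoms G n p) 0 1 = mu.
Proof.
  intros GL Gmu; apply is_RInt_unique.
  replace mu with (sum_f_R0 (fun i => p i * mu) n) by (rewrite <- scal_sum, p1; ring).
  assert (N0 : 0 < INR (S n)) by (apply lt_0_INR; lia).
  assert (term : forall i, (i <= n)%nat ->
    is_RInt (fun t => p i * G t (INR i / INR (S n))) 0 1 (p i * mu)).
  { intros i Hi; apply (is_RInt_scal (fun t => G t (INR i / INR (S n)))).
    rewrite <- (Gmu (INR i / INR (S n))).
    - apply (@RInt_correct R_CompleteNormedModule), ex_RInt_cont.
      apply (lipschitz_continuous L), GL.
    - split; [apply Rdiv_le_0_compat; [apply pos_INR|exact N0]|].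
      apply Rle_div_l; [exact N0|]; rewrite Rmult_1_l; apply le_INR; lia. }
  unfold atoms; assert (H : forall m, (m <= n)%nat ->
    is_RInt (fun t => sum_f_R0 (fun i => p i * G t (INR i / INR (S n))) m) 0 1
      (sum_f_R0 (fun i => p i * mu) m)).
  { induction m as [|m IH]; intros Hm; [apply term; lia|].
    apply (is_RInt_plus (fun t => sum_f_R0 (fun i => p i * G t (INR i / INR (S n))) m)
       (fun t => p (S m) * G t (INR (S m) / INR (S n)))); [apply IH; lia|apply term; lia]. }
  apply H; lia.
Qed.

Lemma atoms_close q d t : (forall t s, Rabs (G t s) <= B) ->
  (forall i, (i <= n)%nat -> Rabs (q i - p i) <= d) ->
  Rabs (atoms G n q t - atoms G n p t) <= d * B * INR (S n).
Proof.
  intros GB H; unfold atoms; rewrite <- minus_sum, <- sum_cte.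
  apply sum_abs_le; intros i Hi; rewrite <- Rmult_minus_distr_r, Rabs_mult.
  apply Rmult_le_compat; auto using Rabs_pos.
Qed.

End Atoms.

(** Each cell keeps its exact mass of [b] and only [g] is frozen at the left end, so the error
    involves no modulus of continuity of [b]. *)
Lemma quadrature_error (g b : R -> R) (L : R) n :
  0 <= L -> lipschitz L g -> (forall t, continuous b t) ->
  (forall t, 0 <= t <= 1 -> 0 <= b t) ->
  Rabs (sum_f_R0 (fun i => RInt b (INR i / INR (S n)) (INR (S i) / INR (S n)) *
          g (INR i / INR (S n))) n - RInt (fun s => g s * b s) 0 1)
  <= L / INR (S n) * RInt b 0 1.
Proof.
  intros L0 gL cb b0.
  assert (N0 : 0 < INR (S n)) by (apply lt_0_INR; lia).
  assert (cg : forall t, continuous g t) by (apply (lipschitz_continuous L), gL).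
  assert (cgb : forall t, continuous (fun s => g s * b s) t)
    by (intros t; apply (continuous_mult g b); auto).
  assert (csc : forall c t, continuous (fun s => c * b s) t)
    by (intros c t; apply (continuous_scal_r c b), cb).
  rewrite <- (RInt_cells (fun s => g s * b s) n cgb), <- (RInt_cells b n cb), scal_sum, <- minus_sum.
  apply sum_abs_le; intros i Hi.
  set (ti := INR i / INR (S n)); set (ti' := INR (S i) / INR (S n)).
  assert (Hti : ti' = ti + / INR (S n)) by (unfold ti, ti'; rewrite (S_INR i); field; lra).
  pose proof (Rinv_0_lt_compat _ N0) as NV.
  assert (ti0 : 0 <= ti) by (apply Rdiv_le_0_compat; [apply pos_INR|exact N0]).
  assert (ti1 : ti' <= 1).
  { apply Rle_div_l; [exact N0|]; rewrite Rmult_1_l; apply le_INR; lia. }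
  assert (sc : forall c, RInt b ti ti' * c = RInt (fun s => c * b s) ti ti').
  { intros c; rewrite Rmult_comm; symmetry; apply (RInt_scal b), ex_RInt_cont, cb. }
  rewrite !sc; apply RInt_close; auto; [lra|]; intros s Hs.
  rewrite <- Rmult_minus_distr_r, Rabs_mult, (Rabs_pos_eq (b s)) by (apply b0; lra).
  apply Rmult_le_compat_r; [apply b0; lra|]; eapply Rle_trans; [apply gL|].
  apply Rmult_le_compat_l; [exact L0|]; apply Rabs_le; lra.
Qed.

(** The bound [eps <= 1] lets products of small errors be absorbed into a term linear in [eps]. *)
Lemma zero_of_small x C : (forall eps, 0 < eps <= 1 -> Rabs x <= eps * C) -> x = 0.
Proof.
  intros H; destruct (Req_dec x 0) as [|nx]; [assumption|exfalso].
  assert (x0 := Rabs_pos_lt x nx); assert (C1 := H 1 ltac:(lra)).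
  assert (q : 0 < Rabs x / (2 * C) <= 1).
  { split; [apply Rdiv_lt_0_compat; lra|]; apply Rle_div_l; lra. }
  specialize (H _ q); replace (Rabs x / (2 * C) * C) with (Rabs x / 2) in H by (field; lra); lra.
Qed.

(* The quantities a are the limit masses, p the approximate ones: an excess of M p over a
   controlled from above is controlled in absolute value, both having the same sum. *)
Lemma sum_one_sided (a p d g : nat -> R) (M B : R) n :
  sum_f_R0 a n = M -> sum_f_R0 p n = 1 -> 0 <= B ->
  (forall i, (i <= n)%nat -> Rabs (g i) <= B /\ 0 <= d i /\ M * p i <= a i + d i) ->
  Rabs (M * sum_f_R0 (fun i => p i * g i) n - sum_f_R0 (fun i => a i * g i) n)
  <= 2 * B * sum_f_R0 d n.
Proof.
  intros a1 p1 B0 H; rewrite scal_sum, <- minus_sum.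
  (* A number v <= d with d >= 0 satisfies |v| <= 2 d - v, and the terms v = p i * M - a i cancel in
     the sum. *)
  replace (2 * B * sum_f_R0 d n) with (sum_f_R0 (fun i => (2 * d i - (p i * M - a i)) * B) n).
  - apply sum_abs_le; intros i Hi; destruct (H i Hi) as [gB [d0 pa]].
    replace (p i * g i * M - a i * g i) with ((p i * M - a i) * g i) by ring.
    rewrite Rabs_mult; apply Rmult_le_compat; try apply Rabs_pos; [|exact gB].
    apply Rabs_le; lra.
  - rewrite <- (scal_sum (fun i => 2 * d i - (p i * M - a i)) n B), minus_sum, minus_sum.
    rewrite <- (scal_sum p n M), a1, p1.
    replace (sum_f_R0 (fun i => 2 * d i) n) with (2 * sum_f_R0 d n); [ring|].
    rewrite scal_sum; apply sum_eq; intros i _; ring.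
Qed.

(** Continuity of [Psi] is asked only at bounded functions of mean [mu], which is what the uniform
    limit of the atomic approximations is known to be; this is where a normalizing factor in [Psi]
    is under control. *)
Theorem kernel_eigenfunction (G : R -> R -> R) (B L mu : R) (Psi : (R -> R) -> R -> R) :
  0 <= L -> (forall t s, Rabs (G t s) <= B) ->
  (forall s, lipschitz L (fun t => G t s)) -> (forall t, lipschitz L (G t)) ->
  (forall s, 0 <= s <= 1 -> RInt (fun t => G t s) 0 1 = mu) ->
  (forall y, (forall t, continuous y t) -> forall t, continuous (Psi y) t) ->
  (forall y t, 0 <= t <= 1 -> 0 <= Psi y t) ->
  (forall y, (forall t, continuous y t) -> (forall t, Rabs (y t) <= B) -> RInt y 0 1 = mu ->
     forall eps, 0 < eps -> exists delta, 0 < delta /\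
       forall z, (forall t, continuous z t) ->
       (forall t, 0 <= t <= 1 -> Rabs (z t - y t) <= delta) ->
       forall t, 0 <= t <= 1 -> Rabs (Psi z t - Psi y t) <= eps) ->
  exists y, lipschitz L y /\ (forall t, Rabs (y t) <= B) /\ RInt y 0 1 = mu /\
    forall t, 0 <= t <= 1 -> RInt (Psi y) 0 1 * y t = RInt (fun s => G t s * Psi y s) 0 1.
Proof.
  intros L0 GB GL GL' Gmu cPsi Psi0 Psi_cont.
  assert (B0 : 0 <= B) by (eapply Rle_trans; [apply Rabs_pos|apply (GB 0 0)]).
  pose (cell := fun (b : R -> R) n i => RInt b (INR i / INR (S n)) (INR (S i) / INR (S n))).
  assert (catoms : forall n p, (forall i, 0 <= p i) -> sum_f_R0 p n = 1 ->
    forall t, continuous (atoms G n p) t).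
  { intros n p p0 p1; apply (lipschitz_continuous L), atoms_lipschitz; auto. }
  assert (H : forall n, {p | (forall i, 0 <= p i) /\ sum_f_R0 p n = 1 /\
    forall i, (i <= n)%nat -> p i <= / INR (S n) ^ 2 \/
      exists q, (forall j, 0 <= q j) /\ sum_f_R0 q n = 1 /\
        q i * RInt (Psi (atoms G n q)) 0 1 <= cell (Psi (atoms G n q)) n i /\
        forall j, (j <= n)%nat -> Rabs (q j - p j) <= / INR (S n) ^ 2}).
  { intros n; apply constructive_indefinite_description.
    assert (N0 : 0 < INR (S n)) by (apply lt_0_INR; lia).
    (* With N = n + 1 the grid has denominator N^3: cluster points differ by 1 / N^2 per coordinate,
       hence by at most B / N after summing over the N atoms. *)
    replace (/ INR (S n) ^ 2) with (INR (S n) / INR (S n ^ 3))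
      by (rewrite pow_INR; field; lra).
    apply (Simplex.simplex_cluster n (S n ^ 3) (fun q i =>
        q i * RInt (Psi (atoms G n q)) 0 1 <= cell (Psi (atoms G n q)) n i)).
    - apply Nat.neq_0_lt_0, Nat.pow_nonzero; lia.
    (* A label exists because the cell masses add up to the total mass and the [p i] to 1, so the
       cells cannot all fall short of their share. *)
    - intros p p0 p1; apply NNPP; intros no.
      assert (lt : forall i, (i <= n)%nat ->
        cell (Psi (atoms G n p)) n i < p i * RInt (Psi (atoms G n p)) 0 1).
      { intros i Hi; apply Rnot_le_lt; intros Hle; apply no; exists i; auto. }
      assert (slt : sum_f_R0 (cell (Psi (atoms G n p)) n) n <
        sum_f_R0 (fun i => p i * RInt (Psi (atoms G n p)) 0 1) n).
      { clear - lt; assert (H : forall m, (m <= n)%nat ->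
          sum_f_R0 (cell (Psi (atoms G n p)) n) m <
          sum_f_R0 (fun i => p i * RInt (Psi (atoms G n p)) 0 1) m).
        { induction m as [|m IH]; intros Hm; [apply lt, Hm|]; rewrite !tech5.
          apply Rplus_lt_compat; [apply IH; lia|apply lt, Hm]. }
        apply H; lia. }
      rewrite <- scal_sum, p1 in slt; unfold cell in slt; rewrite RInt_cells in slt; [lra|].
      apply cPsi, catoms; auto. }
  pose (u := fun n => atoms G n (proj1_sig (H n))).
  assert (u_cont : forall n t, continuous (u n) t).
  { intros n; destruct (proj2_sig (H n)) as [p0 [p1 _]]; apply catoms; auto. }
  destruct (equilipschitz_cluster u B L) as [y [yL [yB ylim]]]; [exact L0| | |].
  { intros n t; destruct (proj2_sig (H n)) as [p0 [p1 _]]; apply atoms_bound; auto. }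
  { intros n; destruct (proj2_sig (H n)) as [p0 [p1 _]]; apply atoms_lipschitz; auto. }
  assert (cy := lipschitz_continuous L y yL).
  assert (ymu : RInt y 0 1 = mu).
  { apply Rminus_diag_uniq, (zero_of_small _ 1); intros eps [e0 _].
    destruct (ylim eps O e0) as [n [_ Hn]].
    destruct (proj2_sig (H n)) as [p0 [p1 _]].
    rewrite Rabs_minus_sym, <- (atoms_integral G L mu n (proj1_sig (H n)) p1 GL Gmu).
    replace (eps * 1) with (eps * (1 - 0)) by ring.
    apply RInt_close_const; [lra|exact (u_cont n)|exact cy|exact Hn]. }
  exists y; split; [exact yL|split; [exact yB|split; [exact ymu|]]]; intros t Ht.
  set (b := Psi y); assert (cb : forall t, continuous b t) by (apply cPsi, cy).
  assert (b0 : forall t, 0 <= t <= 1 -> 0 <= b t) by (intros s Hs; apply Psi0, Hs).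
  set (M := RInt b 0 1).
  assert (M0 : 0 <= M).
  { apply RInt_ge_0; [lra|apply ex_RInt_cont, cb|intros s Hs; apply b0; lra]. }
  apply Rminus_diag_uniq.
  (* The three terms come from replacing [y] by its atomic approximation, from the labels, and from
     the quadrature. *)
  apply (zero_of_small _ (M + 2 * B * (3 + M) + L * M)); intros eps [e0 e1].
  destruct (Psi_cont y cy yB ymu eps e0) as [d [d0 Hd]].
  destruct (INR_unbounded (Rmax (2 * B / d) (/ eps))) as [N0 HN0].
  destruct (ylim (Rmin (d / 2) eps) N0) as [n [Hn Hun]]; [apply Rmin_pos; lra|].
  assert (und : forall s, 0 <= s <= 1 -> Rabs (u n s - y s) <= d / 2)
    by (intros s Hs; eapply Rle_trans; [apply Hun, Hs|apply Rmin_l]).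
  assert (une : Rabs (u n t - y t) <= eps)
    by (eapply Rle_trans; [apply Hun, Ht|apply Rmin_r]).
  destruct (proj2_sig (H n)) as [p0 [p1 Hp]]; unfold u in *; clear u u_cont ylim Hun.
  set (p := proj1_sig (H n)) in *.
  assert (nN : INR N0 < INR (S n)) by (apply lt_INR; lia).
  set (N := INR (S n)) in *.
  assert (NB : 2 * B / d < N) by (pose proof (Rmax_l (2 * B / d) (/ eps)); lra).
  assert (Ne : / eps < N) by (pose proof (Rmax_r (2 * B / d) (/ eps)); lra).
  assert (N1 : 0 < N) by (pose proof (Rinv_0_lt_compat _ e0); lra).
  assert (NV := Rinv_0_lt_compat _ N1).
  assert (NVe : / N <= eps).
  { rewrite <- (Rinv_inv eps); apply Rinv_le_contravar; [apply Rinv_0_lt_compat, e0|lra]. }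
  assert (BN : B * / N <= d / 2).
  { apply Rmult_lt_compat_r with (r := d * / N) in NB; [|apply Rmult_lt_0_compat; lra].
    replace (2 * B / d * (d * / N)) with (2 * (B * / N)) in NB by (field; lra).
    replace (N * (d * / N)) with d in NB by (field; lra); lra. }
  assert (N2 : / N ^ 2 = / N * / N) by (field; lra).
  assert (N2p : 0 <= / N ^ 2) by (rewrite N2; nra).
  assert (a0 : forall i, (i <= n)%nat -> 0 <= INR i / N /\ INR i / N <= INR (S i) / N /\
      INR (S i) / N <= 1 /\ INR (S i) / N - INR i / N = / N).
  { intros i Hi; rewrite S_INR; assert (INR i + 1 <= N) by (unfold N; rewrite <- S_INR; apply le_INR; lia).
    assert (0 <= INR i) by apply pos_INR; unfold Rdiv.
    repeat split; try nra.
    apply Rmult_le_reg_r with N; [exact N1|]; rewrite Rmult_assoc, Rinv_l; lra. }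
  (* A coordinate of size 1 / N^2 is negligible. Otherwise the label inequality holds at a neighbour
     [q]; its atomic function is within [d] of [y] (half from [p], half from the limit), so the
     inequality passes to [p] and [b] with small errors. *)
  assert (key : forall i, (i <= n)%nat ->
    M * p i <= cell b n i + (eps * / N + eps * p i + (eps + M) * / N ^ 2)).
  { intros i Hi; destruct (a0 i Hi) as [i0 [ii [i1 ih]]].
    assert (ci : 0 <= cell b n i).
    { apply RInt_ge_0; [exact ii|apply ex_RInt_cont, cb|intros s Hs; apply b0; unfold N in *; lra]. }
    pose proof (p0 i) as p0i.
    destruct (Hp i Hi) as [Hsmall|[q [q0 [q1 [gq near]]]]]; [nra|].
    assert (cq := catoms n q q0 q1).
    assert (cl : forall s, 0 <= s <= 1 -> Rabs (Psi (atoms G n q) s - b s) <= eps).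
    { apply Hd; [exact cq|]; intros s Hs.
      pose proof (atoms_close G B n p q (/ N ^ 2) s GB near) as h1; fold N in h1.
      replace (/ N ^ 2 * B * N) with (B * / N) in h1 by (field; lra).
      pose proof (und s Hs) as h2.
      replace (atoms G n q s - y s) with ((atoms G n q s - atoms G n p s) + (atoms G n p s - y s)) by ring.
      eapply Rle_trans; [apply Rabs_triang|]; lra. }
    assert (I1 : Rabs (RInt (Psi (atoms G n q)) 0 1 - M) <= eps * (1 - 0))
      by (apply RInt_close_const; auto; lra).
    assert (I2 : Rabs (cell (Psi (atoms G n q)) n i - cell b n i) <= eps * / N).
    { rewrite <- ih; apply RInt_close_const; auto.
      intros s Hs; apply cl; unfold N in *; lra. }
    pose proof (near i Hi) as near_i; pose proof (q0 i) as q0i.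
    apply Rabs_le_between in I1; apply Rabs_le_between in I2; apply Rabs_le_between in near_i.
    nra. }
  assert (err1 := sum_one_sided (cell b n) p
    (fun i => eps * / N + eps * p i + (eps + M) * / N ^ 2) (fun i => G t (INR i / N)) M B n
    (RInt_cells b n cb) p1 B0).
  assert (err2 := quadrature_error (G t) b L n L0 (GL' t) cb b0); fold N M in err2.
  fold (atoms G n p t) in err1.
  rewrite plus_sum, plus_sum, !sum_cte in err1.
  replace (sum_f_R0 (fun i => eps * p i) n) with eps in err1.
  2:{ transitivity (eps * sum_f_R0 p n); [rewrite p1; ring|].
      rewrite scal_sum; apply sum_eq; intros i _; ring. }
  fold N in err1; replace (eps * / N * N) with eps in err1 by (field; lra).
  replace ((eps + M) * / N ^ 2 * N) with ((eps + M) * / N) in err1 by (field; lra).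
  assert (err1' := err1 ltac:(intros i Hi; split; [apply GB|split;
    [pose proof (p0 i); nra|apply key, Hi]])).
  unfold cell in err1'.
  assert (e3 : Rabs (M * (y t - atoms G n p t)) <= M * eps).
  { rewrite Rabs_mult, (Rabs_pos_eq M) by exact M0; apply Rmult_le_compat_l; [exact M0|].
    rewrite Rabs_minus_sym; exact une. }
  match type of err2 with Rabs (?s - ?i) <= _ =>
    replace (M * y t - i) with (M * (y t - atoms G n p t) + (M * atoms G n p t - s) + (s - i)) by ring
  end.
  eapply Rle_trans; [apply Rabs_triang|].
  eapply Rle_trans; [apply Rplus_le_compat_r, Rabs_triang|].
  assert (h1 : (eps + M) * / N <= (1 + M) * eps) by nra.
  assert (h2 : L / N * M <= L * M * eps).
  { unfold Rdiv; rewrite (Rmult_comm L (/ N)), Rmult_assoc, Rmult_comm.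
    apply Rmult_le_compat_l; [nra|exact NVe]. }
  assert (h3 : 2 * B * (eps + eps + (eps + M) * / N) <= 2 * B * (eps + eps + (1 + M) * eps))
    by (apply Rmult_le_compat_l; lra).
  apply Rle_trans with (M * eps + 2 * B * (eps + eps + (eps + M) * / N) + L / N * M); [|lra].
  apply Rplus_le_compat; [apply Rplus_le_compat; [exact e3|exact err1']|exact err2].
Qed.

(** * The L^p norm *)

Lemma rpow_ge_0 a q : 0 <= rpow a q.
Proof. unfold rpow; destruct Rle_dec; [lra|left; apply exp_pos]. Qed.

Lemma rpow_gt_0 a q : 0 < a -> 0 < rpow a q.
Proof. intros H; unfold rpow; destruct Rle_dec; [lra|apply exp_pos]. Qed.

Lemma rpow_Rpower a q : 0 < a -> rpow a q = Rpower a q.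
Proof. intros H; unfold rpow; destruct Rle_dec; [lra|reflexivity]. Qed.

Lemma rpow_0 q : rpow 0 q = 0.
Proof. unfold rpow; destruct Rle_dec; [reflexivity|lra]. Qed.

Lemma rpow_mult a b q : 0 <= a -> 0 <= b -> rpow (a * b) q = rpow a q * rpow b q.
Proof.
  intros [a0|<-] [b0|<-]; rewrite ?Rmult_0_l, ?Rmult_0_r, ?rpow_0; try ring.
  rewrite !rpow_Rpower, Rpower_mult_distr; auto; apply Rmult_lt_0_compat; auto.
Qed.

Lemma rpow_lt a b q : 0 < q -> 0 <= a < b -> rpow a q < rpow b q.
Proof.
  intros q0 [[a0|<-] ab]; [|rewrite rpow_0; apply rpow_gt_0, ab].
  rewrite !rpow_Rpower by lra; apply Rlt_Rpower_l; lra.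
Qed.

Lemma rpow_le a b q : 0 < q -> 0 <= a <= b -> rpow a q <= rpow b q.
Proof.
  intros q0 [a0 [ab|<-]]; [left; apply rpow_lt; auto|right; reflexivity].
Qed.

Lemma rpow_root a p : 1 <= p -> 0 <= a -> rpow (rpow a p) (1 / p) = a.
Proof.
  intros p1 [a0|<-]; [|rewrite !rpow_0; reflexivity].
  rewrite (rpow_Rpower _ (1 / p)), rpow_Rpower, Rpower_mult; auto using rpow_gt_0.
  replace (p * (1 / p)) with 1 by (field; lra); apply Rpower_1, a0.
Qed.

Lemma continuous_rpow a q : 0 < a -> continuous (fun u => rpow u q) a.
Proof.
  intros a0; apply continuous_ext_loc with (fun u => exp (q * ln u)).
  - exists (mkposreal a a0); intros u Hu; apply Rabs_lt_between' in Hu; simpl in Hu.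
    rewrite rpow_Rpower by lra; reflexivity.
  - apply (@ex_derive_continuous R_AbsRing R_NormedModule); auto_derive; exact a0.
Qed.

Lemma continuous_rpow_Rabs p u : 1 <= p -> continuous (fun u => rpow (Rabs u) p) u.
Proof.
  intros p1; destruct (Req_dec u 0) as [->|nu].
  - apply continuous_eps; intros eps e0; exists (Rmin 1 eps); split; [apply Rmin_pos; lra|].
    intros s Hs; rewrite Rminus_0_r in Hs; rewrite Rabs_R0, rpow_0, Rminus_0_r.
    assert (h1 := Rmin_l 1 eps); assert (h2 := Rmin_r 1 eps).
    rewrite Rabs_pos_eq by apply rpow_ge_0.
    destruct (Req_dec s 0) as [->|ns]; [rewrite Rabs_R0, rpow_0; exact e0|].
    assert (s0 := Rabs_pos_lt s ns); rewrite rpow_Rpower by exact s0.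
    apply Rle_lt_trans with (Rabs s); [|lra].
    rewrite <- (exp_ln (Rabs s)) at 2 by exact s0.
    assert (ln (Rabs s) < 0) by (rewrite <- ln_1; apply ln_increasing; lra).
    unfold Rpower; destruct (Req_dec p 1) as [->|np]; [rewrite Rmult_1_l; lra|].
    left; apply exp_increasing; nra.
  - apply (continuous_comp Rabs (fun v => rpow v p)); [apply continuous_Rabs|].
    apply continuous_rpow, Rabs_pos_lt, nu.
Qed.

(** The tangent at [m] to the convex power function. With v = ln (a / m) it reads 1 + p (e^v - 1) <=
    e^(p v), which follows from 1 + x <= e^x at x = (p - 1) v and x = - v. *)
Lemma rpow_tangent p a m : 1 <= p -> 0 <= a -> 0 < m ->
  rpow m p * (1 + p * (a / m - 1)) <= rpow a p.
Proof.
  intros p1 [a0|<-] m0.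
  2:{ rewrite rpow_0; assert (h := rpow_gt_0 m p m0).
      replace (0 / m) with 0 by (field; lra); nra. }
  assert (b0 : 0 < a / m) by (apply Rdiv_lt_0_compat; auto).
  replace a with (m * (a / m)) at 2 by (field; lra).
  rewrite rpow_mult by lra; apply Rmult_le_compat_l; [apply rpow_ge_0|].
  rewrite rpow_Rpower by exact b0; unfold Rpower.
  set (v := ln (a / m)); rewrite <- (exp_ln (a / m)) by exact b0; fold v.
  assert (h1 := exp_ineq1_le ((p - 1) * v)); assert (h2 := exp_ineq1_le (- v)).
  assert (v0 := exp_pos v).
  replace (p * v) with (v + (p - 1) * v) by ring; rewrite exp_plus.
  assert (h3 : exp v * exp (- v) = 1)
    by (rewrite <- exp_plus, Rplus_opp_r; apply exp_0).
  apply (Rmult_le_compat_l (exp v)) in h1; [|lra].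
  apply (Rmult_le_compat_l ((p - 1) * exp v)) in h2; [|apply Rmult_le_pos; lra].
  rewrite (Rmult_assoc _ _ (exp (- v))), h3 in h2; lra.
Qed.

Section LpNorm.

Variable p : R.
Hypothesis p1 : 1 <= p.

Lemma pth_root_gt_0 : 0 < 1 / p.
Proof. apply Rdiv_lt_0_compat; lra. Qed.

Lemma continuous_rpow_comp (y : R -> R) : (forall t, continuous y t) ->
  forall t, continuous (fun s => rpow (Rabs (y s)) p) t.
Proof.
  intros cy t; apply (continuous_comp y (fun u => rpow (Rabs u) p)); [apply cy|].
  apply continuous_rpow_Rabs, p1.
Qed.

Lemma RInt_rpow_ge_0 (y : R -> R) : (forall t, continuous y t) ->
  0 <= RInt (fun t => rpow (Rabs (y t)) p) 0 1.
Proof.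
  intros cy; apply RInt_ge_0; [lra| |intros; apply rpow_ge_0].
  apply ex_RInt_cont, continuous_rpow_comp, cy.
Qed.

Lemma Lp_norm01_scal c (y : R -> R) : 0 <= c -> (forall t, continuous y t) ->
  Lp_norm01 p (fun t => c * y t) = c * Lp_norm01 p y.
Proof.
  intros c0 cy; unfold Lp_norm01.
  transitivity (rpow (rpow c p) (1 / p) * rpow (RInt (fun t => rpow (Rabs (y t)) p) 0 1) (1 / p));
    [|rewrite rpow_root; auto].
  rewrite <- rpow_mult; [|apply rpow_ge_0|apply RInt_rpow_ge_0, cy]; f_equal.
  transitivity (RInt (fun t => rpow c p * rpow (Rabs (y t)) p) 0 1).
  - apply RInt_ext; intros t _; rewrite <- rpow_mult; auto using Rabs_pos.
    rewrite Rabs_mult, (Rabs_pos_eq c); auto.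
  - apply (RInt_scal (fun t => rpow (Rabs (y t)) p)), ex_RInt_cont, continuous_rpow_comp, cy.
Qed.

(** Jensen's inequality: the tangent taken at the mean of [y] integrates to the power of the
    mean. *)
Lemma RInt_rpow_ge (y : R -> R) : (forall t, continuous y t) -> 0 < RInt y 0 1 ->
  rpow (RInt y 0 1) p <= RInt (fun t => rpow (Rabs (y t)) p) 0 1.
Proof.
  intros cy m0; assert (exists m : R, m = RInt y 0 1) as [m Em] by eauto; rewrite <- Em in *.
  assert (cg : forall t, continuous (fun t => rpow m p * (1 + p * (y t / m - 1))) t).
  { intros t; apply (continuous_scal_r (rpow m p) (fun t => 1 + p * (y t / m - 1))).
    apply (continuous_plus (fun _ => 1)); [apply continuous_const|].
    apply (continuous_scal_r p (fun t => y t / m - 1)).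
    apply (continuous_minus (fun t => y t / m)); [|apply continuous_const].
    apply (continuous_mult y (fun _ => / m)); [apply cy|apply continuous_const]. }
  replace (rpow m p) with (RInt (fun t => rpow m p * (1 + p * (y t / m - 1))) 0 1).
  - apply RInt_le; [lra|apply ex_RInt_cont, cg|apply ex_RInt_cont, continuous_rpow_comp, cy|].
    intros t _; eapply Rle_trans; [|apply rpow_tangent with (m := m); auto using Rabs_pos].
    apply Rmult_le_compat_l; [apply rpow_ge_0|]; apply Rplus_le_compat_l.
    apply Rmult_le_compat_l; [lra|]; apply Rplus_le_compat_r.
    apply Rmult_le_compat_r; [left; apply Rinv_0_lt_compat, m0|apply Rle_abs].
  - transitivity (rpow m p * p / m * m + (1 - 0) * (rpow m p * (1 - p)));
      [|match goal with |- ?a = ?b => change (@eq R a b) end; field; lra].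
    apply is_RInt_unique.
    eapply is_RInt_ext; [|apply (is_RInt_plus (fun t => rpow m p * p / m * y t) (fun _ => rpow m p * (1 - p)))].
    + intros t _; unfold plus; simpl; field; lra.
    + apply (is_RInt_scal y); rewrite Em; apply (@RInt_correct R_CompleteNormedModule), ex_RInt_cont, cy.
    + exact (@is_RInt_const R_NormedModule 0 1 (rpow m p * (1 - p))).
Qed.

Lemma Lp_norm01_ge_mean (y : R -> R) : (forall t, continuous y t) -> 0 < RInt y 0 1 ->
  RInt y 0 1 <= Lp_norm01 p y.
Proof.
  intros cy m0; rewrite <- (rpow_root (RInt y 0 1) p) by lra.
  apply rpow_le; [apply pth_root_gt_0|split; [apply rpow_ge_0|]].
  apply RInt_rpow_ge; auto.
Qed.

(** This locates a time at which the positivity hypothesis on f applies to the normalized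
    function. *)
Lemma Lp_norm01_attained (y : R -> R) rho : (forall t, continuous y t) -> 0 <= rho ->
  Lp_norm01 p y = rho -> exists t, 0 <= t <= 1 /\ rho <= Rabs (y t).
Proof.
  intros cy r0 yr; apply NNPP; intros no.
  assert (lt : forall t, 0 <= t <= 1 -> Rabs (y t) < rho).
  { intros t Ht; apply Rnot_le_lt; intros le; apply no; exists t; auto. }
  assert (h : RInt (fun t => rpow (Rabs (y t)) p) 0 1 < RInt (fun _ => rpow rho p) 0 1).
  { apply RInt_lt; [lra|intros; apply continuous_const|intros; apply continuous_rpow_comp, cy|].
    intros t Ht; apply rpow_lt; [lra|split; [apply Rabs_pos|apply lt; lra]]. }
  assert (e : RInt (fun _ => rpow rho p) 0 1 = rpow rho p).
  { rewrite RInt_const; unfold scal; simpl; unfold mult; simpl; ring. }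
  rewrite e in h; assert (h' := rpow_lt _ _ (1 / p) pth_root_gt_0 (conj (RInt_rpow_ge_0 y cy) h)).
  fold (Lp_norm01 p y) in h'; rewrite rpow_root in h'; lra.
Qed.

Lemma uniform_continuity_segment (g : R -> R) a b : (forall t, continuous g t) ->
  forall eps, 0 < eps -> exists delta, 0 < delta /\
    forall s t, a <= s <= b -> a <= t <= b -> Rabs (s - t) < delta -> Rabs (g s - g t) < eps.
Proof.
  intros cg eps e0.
  destruct (uniform_continuity_2d (fun _ u => g u) 0 1 a b) with (eps := mkposreal eps e0) as [d Hd].
  - intros x t _ _ e; destruct (proj2 (continuous_eps g t) (cg t) e (cond_pos e)) as [d [d0 Hd]].
    exists (mkposreal d d0); intros u v _ Hv; apply Hd, Hv.
  - exists d; split; [apply cond_pos|]; intros s t Hs Ht Hst.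
    apply (Hd 0 t 0 s); auto; try lra; rewrite Rminus_0_r, Rabs_R0; apply cond_pos.
Qed.

(** The positive mean makes the integral under the root positive, where [continuous_rpow] applies;
    the bound [C] confines all values to a segment on which the power is uniformly continuous. *)
Lemma Lp_norm01_continuous (y : R -> R) C : (forall t, continuous y t) ->
  (forall t, Rabs (y t) <= C) -> 0 < RInt y 0 1 ->
  forall eps, 0 < eps -> exists delta, 0 < delta /\
    forall z, (forall t, continuous z t) ->
    (forall t, 0 <= t <= 1 -> Rabs (z t - y t) <= delta) ->
    Rabs (Lp_norm01 p z - Lp_norm01 p y) < eps.
Proof.
  intros cy yC m0 eps e0.
  assert (J0 : 0 < RInt (fun t => rpow (Rabs (y t)) p) 0 1).
  { eapply Rlt_le_trans; [apply (rpow_gt_0 _ p m0)|apply RInt_rpow_ge; auto]. }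
  destruct (proj2 (continuous_eps _ _) (continuous_rpow _ (1 / p) J0) eps e0) as [d [d0 Hd]].
  destruct (uniform_continuity_segment (fun u => rpow (Rabs u) p) (- (C + 1)) (C + 1)
    (fun u => continuous_rpow_Rabs p u p1) (d / 2)) as [d' [d'0 Hd']]; [lra|].
  exists (Rmin 1 (d' / 2)); split; [apply Rmin_pos; lra|]; intros z cz zy.
  apply Hd; apply Rle_lt_trans with (d / 2 * (1 - 0)); [|lra].
  apply RInt_close_const; [lra|apply continuous_rpow_comp, cz|apply continuous_rpow_comp, cy|].
  intros t Ht; specialize (zy t Ht); specialize (yC t).
  assert (h1 := Rmin_l 1 (d' / 2)); assert (h2 := Rmin_r 1 (d' / 2)).
  left; apply Hd'; [| |lra]; apply Rabs_le_between in yC; [|lra].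
  apply Rabs_le_between in zy; lra.
Qed.

End LpNorm.

(** * Extension of f to the plane and continuity of the normalized superposition *)

Definition extend (r : R) (f : R -> R -> R) (t u : R) : R := f (clamp 0 1 t) (clamp (- r) r u).

Section Extension.

Variables (r : R) (f : R -> R -> R).
Hypothesis r0 : 0 <= r.
Hypothesis cf : cont_on_rect r f.

Lemma extend_id t u : 0 <= t <= 1 -> Rabs u <= r -> extend r f t u = f t u.
Proof.
  intros Ht Hu; apply Rabs_le_between in Hu; unfold extend; rewrite !clamp_id; auto.
Qed.

Lemma extend_continuous t u eps : 0 < eps -> exists delta, 0 < delta /\
  forall t' u', Rabs (t' - t) < delta -> Rabs (u' - u) < delta ->
  Rabs (extend r f t' u' - extend r f t u) < eps.
Proof.
  intros e0.
  destruct (cf (clamp 0 1 t) (clamp (- r) r u)) with (eps := eps) as [d [d0 Hd]];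
    try (apply clamp_in; lra); [exact e0|].
  exists d; split; [exact d0|]; intros t' u' Ht Hu; apply Hd; try (apply clamp_in; lra);
    (eapply Rle_lt_trans; [apply clamp_lip|assumption]).
Qed.

(** Clamping the arguments leaves [extend] unchanged, so a modulus on the compact rectangle serves
    for all real arguments. *)
Lemma extend_unif eps : 0 < eps -> exists delta, 0 < delta /\
  forall t u u', Rabs (u' - u) < delta -> Rabs (extend r f t u' - extend r f t u) < eps.
Proof.
  intros e0.
  destruct (uniform_continuity_2d (extend r f) 0 1 (- r) r) with (eps := mkposreal eps e0) as [d Hd].
  - intros t u _ _ e; destruct (extend_continuous t u e (cond_pos e)) as [d [d0 Hd]].
    exists (mkposreal d d0); intros t' u' Ht Hu; apply Hd; assumption.
  - exists d; split; [apply cond_pos|]; intros t u u' Hu.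
    assert (cl : forall t u, extend r f t u = extend r f (clamp 0 1 t) (clamp (- r) r u)).
    { intros; unfold extend; rewrite !(clamp_id _ _ (clamp _ _ _)); auto; apply clamp_in; lra. }
    rewrite (cl t u'), (cl t u); apply Hd; try (apply clamp_in; lra).
    + rewrite Rminus_diag, Rabs_R0; apply cond_pos.
    + eapply Rle_lt_trans; [apply clamp_lip|exact Hu].
Qed.

Lemma continuous_extend_comp (y : R -> R) : (forall t, continuous y t) ->
  forall t, continuous (fun s => extend r f s (y s)) t.
Proof.
  intros cy t; apply continuous_eps; intros eps e0.
  destruct (extend_continuous t (y t) eps e0) as [d [d0 Hd]].
  destruct (proj2 (continuous_eps y t) (cy t) d d0) as [d' [d'0 Hd']].
  exists (Rmin d d'); split; [apply Rmin_pos; auto|]; intros s Hs.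
  assert (h1 := Rmin_l d d'); assert (h2 := Rmin_r d d').
  apply Hd; [lra|]; apply Hd'; lra.
Qed.

Lemma extend_normalized_continuous p rho C (y : R -> R) : 1 <= p -> 0 < rho ->
  (forall t, continuous y t) -> (forall t, Rabs (y t) <= C) -> 0 < RInt y 0 1 ->
  forall eps, 0 < eps -> exists delta, 0 < delta /\
    forall z, (forall t, continuous z t) ->
    (forall t, 0 <= t <= 1 -> Rabs (z t - y t) <= delta) ->
    forall t, 0 <= t <= 1 ->
    Rabs (extend r f t (rho / Lp_norm01 p z * z t) - extend r f t (rho / Lp_norm01 p y * y t)) <= eps.
Proof.
  intros p1 rho0 cy yC m0 eps e0.
  assert (ny0 : 0 < Lp_norm01 p y)
    by (eapply Rlt_le_trans; [exact m0|apply Lp_norm01_ge_mean; auto]).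
  set (ny := Lp_norm01 p y) in *.
  assert (C0 : 0 <= C) by (eapply Rle_trans; [apply Rabs_pos|apply (yC 0)]).
  destruct (extend_unif eps e0) as [dF [dF0 HdF]].
  (* Over the common denominator nz * ny > ny^2 / 2 the numerator is at most 2 rho e = dF ny^2 / 4,
     which leaves less than [dF]. *)
  pose (e := dF * ny ^ 2 / (8 * rho)).
  assert (e1 : 0 < e).
  { unfold e; apply Rdiv_lt_0_compat; [apply Rmult_lt_0_compat; [exact dF0|apply pow_lt, ny0]|lra]. }
  destruct (Lp_norm01_continuous p p1 y C cy yC m0 (Rmin (ny / 2) (e / (C + 1)))) as [d [d0 Hd]].
  { apply Rmin_pos; [lra|apply Rdiv_lt_0_compat; lra]. }
  exists (Rmin d (e / ny)); split; [apply Rmin_pos; [exact d0|apply Rdiv_lt_0_compat; lra]|].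
  intros z cz zy t Ht; left; apply HdF.
  assert (hz : Rabs (Lp_norm01 p z - ny) < Rmin (ny / 2) (e / (C + 1))).
  { apply Hd; [exact cz|]; intros s Hs; eapply Rle_trans; [apply zy, Hs|apply Rmin_l]. }
  set (nz := Lp_norm01 p z) in *.
  assert (hz1 := Rlt_le_trans _ _ _ hz (Rmin_l _ _)).
  assert (hz2 := Rlt_le_trans _ _ _ hz (Rmin_r _ _)).
  assert (zt := Rle_trans _ _ _ (zy t Ht) (Rmin_r _ _)).
  apply Rabs_lt_between in hz1.
  replace (rho / nz * z t - rho / ny * y t)
    with (rho * ((z t - y t) * ny - y t * (nz - ny)) / (nz * ny)) by (field; lra).
  assert (num : Rabs ((z t - y t) * ny - y t * (nz - ny)) <= 2 * e).
  { replace ((z t - y t) * ny - y t * (nz - ny)) with ((z t - y t) * ny + - (y t * (nz - ny))) by ring.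
    eapply Rle_trans; [apply Rabs_triang|]; rewrite Rabs_Ropp, !Rabs_mult, (Rabs_pos_eq ny) by lra.
    assert (Rabs (z t - y t) * ny <= e).
    { apply (Rmult_le_compat_r ny) in zt; [|lra].
      replace (e / ny * ny) with e in zt by (field; lra); exact zt. }
    assert (Rabs (y t) * Rabs (nz - ny) <= C * (e / (C + 1))).
    { apply Rmult_le_compat; auto using Rabs_pos; lra. }
    assert (C * (e / (C + 1)) <= e).
    { replace (C * (e / (C + 1))) with (C * e / (C + 1)) by (field; lra).
      apply Rle_div_l; [lra|nra]. }
    lra. }
  assert (nn : 0 < nz * ny) by (apply Rmult_lt_0_compat; lra).
  rewrite Rabs_div, Rabs_mult, (Rabs_pos_eq rho), (Rabs_pos_eq (nz * ny)) by lra.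
  apply Rlt_div_l; [exact nn|].
  apply Rle_lt_trans with (rho * (2 * e)); [apply Rmult_le_compat_l; [lra|exact num]|].
  replace (rho * (2 * e)) with (dF * (ny ^ 2 / 4)) by (unfold e; field; lra).
  apply Rmult_lt_compat_l; [exact dF0|]; nra.
Qed.

End Extension.

(** * The periodic Green function *)

Lemma cos_lipschitz a b : Rabs (cos a - cos b) <= Rabs (a - b).
Proof.
  destruct (MVT_gen cos b a (fun x => - sin x)) as [c [_ Hc]].
  - intros x _; auto_derive; auto; ring.
  - intros x _; apply continuity_cos.
  - rewrite Hc, Rabs_mult, Rabs_Ropp.
    apply Rle_trans with (1 * Rabs (a - b)); [|lra]; apply Rmult_le_compat_r; [apply Rabs_pos|]; apply Rabs_le, SIN_bound.
Qed.

Definition green (omega t s : R) : R :=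
  cos (omega * (1 / 2 - Rabs (t - s))) / (2 * omega * sin (omega / 2)).

Section Green.

Variable omega : R.
Hypothesis omega0 : 0 < omega.
Hypothesis sin0 : sin (omega / 2) <> 0.

Let D := 2 * omega * sin (omega / 2).

Lemma green_denominator : D <> 0.
Proof. unfold D; apply Rmult_integral_contrapositive; split; lra. Qed.

Lemma Rabs_green_denominator : Rabs D = 2 * omega * Rabs (sin (omega / 2)).
Proof. unfold D; rewrite Rabs_mult, Rabs_pos_eq; lra. Qed.

Lemma green_sym t s : green omega t s = green omega s t.
Proof. unfold green; rewrite Rabs_minus_sym; reflexivity. Qed.

Lemma green_bound t s : Rabs (green omega t s) <= / Rabs D.
Proof.
  unfold green; fold D; rewrite Rabs_div by apply green_denominator.
  rewrite <- (Rmult_1_l (/ Rabs D)); apply Rmult_le_compat_r.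
  - left; apply Rinv_0_lt_compat, Rabs_pos_lt, green_denominator.
  - apply Rabs_le, COS_bound.
Qed.

Lemma green_lipschitz_r t : lipschitz (omega / Rabs D) (green omega t).
Proof.
  intros s s'; unfold green; fold D; unfold Rdiv.
  rewrite <- Rmult_minus_distr_r, Rabs_mult, Rabs_inv.
  replace (omega * / Rabs D * Rabs (s - s')) with (omega * Rabs (s - s') * / Rabs D) by ring.
  apply Rmult_le_compat_r; [left; apply Rinv_0_lt_compat, Rabs_pos_lt, green_denominator|].
  eapply Rle_trans; [apply cos_lipschitz|].
  rewrite <- Rmult_minus_distr_l, Rabs_mult, (Rabs_pos_eq omega) by lra.
  apply Rmult_le_compat_l; [lra|].
  unfold Rabs; repeat destruct Rcase_abs; lra.
Qed.

Lemma green_lipschitz_l s : lipschitz (omega / Rabs D) (fun t => green omega t s).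
Proof.
  intros t t'; rewrite !(green_sym _ s); apply green_lipschitz_r.
Qed.

(* For t in [0,1] this is the integral of green omega t s * b s ds expanded by the addition
   formulas, with C and S the primitives of cos (omega s) * b s and sin (omega s) * b s; unlike
   that integral, it solves the differential equation on all of R. *)
Definition response (C S : R -> R) (t : R) : R :=
  (cos (omega / 2 - omega * t) * C t - sin (omega / 2 - omega * t) * S t
   + cos (omega / 2 + omega * t) * (C 1 - C t) + sin (omega / 2 + omega * t) * (S 1 - S t)) / D.

Definition response' (C S : R -> R) (t : R) : R :=
  omega * (sin (omega / 2 - omega * t) * C t + cos (omega / 2 - omega * t) * S t
   - sin (omega / 2 + omega * t) * (C 1 - C t) + cos (omega / 2 + omega * t) * (S 1 - S t)) / D.

Lemma response_periodic C S : C 0 = 0 -> S 0 = 0 ->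
  response C S 0 = response C S 1 /\ response' C S 0 = response' C S 1.
Proof.
  intros C0 S0; unfold response, response'; rewrite C0, S0.
  replace (omega / 2 - omega * 1) with (- (omega / 2)) by field.
  replace (omega / 2 - omega * 0) with (omega / 2) by ring.
  replace (omega / 2 + omega * 0) with (omega / 2) by ring.
  rewrite sin_neg, cos_neg; split;
    field; apply green_denominator.
Qed.

Section Primitives.

Variables (b C S : R -> R).
Hypothesis dC : forall t, is_derive C t (cos (omega * t) * b t).
Hypothesis dS : forall t, is_derive S t (sin (omega * t) * b t).

(** The terms containing [b t] cancel, which expresses the continuity of the kernel on the
    diagonal. *)
Lemma is_derive_response t : is_derive (response C S) t (response' C S t).
Proof.
  unfold response, response'.
  auto_derive; [repeat split; eexists; apply dC || apply dS|].
  rewrite (is_derive_unique (fun x : R => C x) t _ (dC t)), (is_derive_unique (fun x : R => S x) t _ (dS t)).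
  unfold Rminus; rewrite !cos_plus, !sin_plus, !cos_neg, !sin_neg.
  field; apply green_denominator.
Qed.

Lemma is_derive_response' t :
  is_derive (response' C S) t (b t - omega ^ 2 * response C S t).
Proof.
  unfold response, response'.
  auto_derive; [repeat split; eexists; apply dC || apply dS|].
  rewrite (is_derive_unique (fun x : R => C x) t _ (dC t)), (is_derive_unique (fun x : R => S x) t _ (dS t)).
  (* The unit jump of the kernel's derivative across the diagonal. Keeping the sum of squares
     unsimplified matches what the addition formulas produce, so that [field] can conclude. *)
  assert (h : b t = omega * b t * (2 * sin (omega / 2)
    * (sin (omega * t) * sin (omega * t) + cos (omega * t) * cos (omega * t))) / D).
  { assert (h := sin2_cos2 (omega * t)); unfold Rsqr in h; rewrite h; unfold D; field; lra. }
  transitivity (omega * b t * (2 * sin (omega / 2)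
    * (sin (omega * t) * sin (omega * t) + cos (omega * t) * cos (omega * t))) / D
    - omega ^ 2 * response C S t); [|rewrite <- h; reflexivity].
  unfold response, Rminus; rewrite !cos_plus, !sin_plus, !cos_neg, !sin_neg.
  field; apply green_denominator.
Qed.

Lemma green_integral t : (forall s, continuous b s) -> C 0 = 0 -> S 0 = 0 -> 0 <= t <= 1 ->
  RInt (fun s => green omega t s * b s) 0 1 = response C S t.
Proof.
  intros cb C0 S0 Ht.
  assert (ctrig : forall (h : R -> R) s, (forall s, ex_derive h s) ->
    continuous (fun s => h s * b s) s).
  { intros h s dh; apply (continuous_mult h b); [|apply cb].
    apply (@ex_derive_continuous R_AbsRing R_NormedModule), dh. }
  assert (IC : forall x y, is_RInt (fun s => cos (omega * s) * b s) x y (C y - C x)).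
  { intros x y; apply (is_RInt_derive C); intros s _; [apply dC|].
    apply (ctrig (fun s => cos (omega * s))); intros; auto_derive; auto. }
  assert (IS : forall x y, is_RInt (fun s => sin (omega * s) * b s) x y (S y - S x)).
  { intros x y; apply (is_RInt_derive S); intros s _; [apply dS|].
    apply (ctrig (fun s => sin (omega * s))); intros; auto_derive; auto. }
  apply is_RInt_unique.
  replace (response C S t) with
    ((cos (omega / 2 - omega * t) / D * (C t - C 0) + - sin (omega / 2 - omega * t) / D * (S t - S 0))
     + (cos (omega / 2 + omega * t) / D * (C 1 - C t) + sin (omega / 2 + omega * t) / D * (S 1 - S t)))
    by (rewrite C0, S0; unfold response; field; apply green_denominator).
  apply (is_RInt_Chasles (fun s => green omega t s * b s) 0 t 1).
  - eapply is_RInt_ext; [|apply (is_RInt_plus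
      (fun s => cos (omega / 2 - omega * t) / D * (cos (omega * s) * b s))
      (fun s => - sin (omega / 2 - omega * t) / D * (sin (omega * s) * b s)));
      [apply (is_RInt_scal (fun s => cos (omega * s) * b s)), IC
      |apply (is_RInt_scal (fun s => sin (omega * s) * b s)), IS]].
    intros s Hs; rewrite Rmin_left, Rmax_right in Hs by lra.
    unfold green; rewrite Rabs_pos_eq by lra; fold D.
    replace (omega * (1 / 2 - (t - s))) with ((omega / 2 - omega * t) + omega * s) by field.
    rewrite cos_plus; unfold plus; simpl; field; apply green_denominator.
  - eapply is_RInt_ext; [|apply (is_RInt_plus
      (fun s => cos (omega / 2 + omega * t) / D * (cos (omega * s) * b s))
      (fun s => sin (omega / 2 + omega * t) / D * (sin (omega * s) * b s)));
      [apply (is_RInt_scal (fun s => cos (omega * s) * b s)), IC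
      |apply (is_RInt_scal (fun s => sin (omega * s) * b s)), IS]].
    intros s Hs; rewrite Rmin_left, Rmax_right in Hs by lra.
    unfold green; rewrite Rabs_left1 by lra; fold D.
    replace (omega * (1 / 2 - - (t - s))) with ((omega / 2 + omega * t) - omega * s) by field.
    rewrite cos_minus; unfold plus; simpl; field; apply green_denominator.
Qed.

End Primitives.

(** By symmetry this is the response to the right-hand side 1, whose periodic solution is the
    constant 1 / omega^2. It is computed from explicit primitives vanishing at 0. *)
Lemma green_mean s : 0 <= s <= 1 -> RInt (fun t => green omega t s) 0 1 = / omega ^ 2.
Proof.
  intros Hs.
  transitivity (RInt (fun t => green omega s t * 1) 0 1).
  { apply RInt_ext; intros t _; rewrite green_sym, Rmult_1_r; reflexivity. }
  rewrite (green_integral (fun _ => 1) (fun t => sin (omega * t) / omega)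
    (fun t => (1 - cos (omega * t)) / omega)); auto.
  - unfold response; rewrite Rmult_1_r.
    (* Half angles bring out the factor sin (omega / 2) of [D]. *)
    replace (sin omega) with (2 * sin (omega / 2) * cos (omega / 2))
      by (rewrite <- sin_2a; f_equal; field).
    replace (cos omega) with (1 - 2 * sin (omega / 2) * sin (omega / 2))
      by (rewrite <- cos_2a_sin; f_equal; field).
    rewrite cos_plus, sin_plus, cos_minus, sin_minus.
    assert (h1 := sin2_cos2 (omega / 2)); assert (h2 := sin2_cos2 (omega * s)).
    unfold Rsqr in *.
    set (A := sin (omega / 2)) in *; set (B := cos (omega / 2)) in *.
    set (X := sin (omega * s)) in *; set (Y := cos (omega * s)) in *.
    assert (k1 : B * B = 1 - A * A) by lra; assert (k2 : Y * Y = 1 - X * X) by lra.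
    apply Rmult_eq_reg_r with (D * omega);
      [|apply Rmult_integral_contrapositive; split; [apply green_denominator|lra]].
    unfold D; fold A.
    transitivity ((B * Y + A * X) * X - (A * Y - B * X) * (1 - Y)
      + (B * Y - A * X) * (2 * A * B - X) + (A * Y + B * X) * (Y - (1 - 2 * A * A))).
    { field; repeat split; lra. }
    transitivity (2 * A); [|field; lra].
    transitivity (2 * A * (X * X + Y * Y) - A * Y + B * X + 2 * A * Y * (B * B)
      - 2 * A * A * X * B - A * Y - B * X + 2 * A * A * A * Y + 2 * A * A * B * X); [ring|].
    rewrite k1, k2; ring.
  - intros t; auto_derive; [auto|field; lra].
  - intros t; auto_derive; [auto|field; lra].
  - intros t; apply continuous_const.
  - rewrite Rmult_0_r, sin_0; field; lra.
  - rewrite Rmult_0_r, cos_0; field; lra.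
Qed.

End Green.

(** * From the eigenfunction to the periodic solution *)

Lemma RInt_gt_0_point (b : R -> R) t : (forall s, continuous b s) ->
  (forall s, 0 <= s <= 1 -> 0 <= b s) -> 0 <= t <= 1 -> 0 < b t -> 0 < RInt b 0 1.
Proof.
  intros cb b0 Ht bt.
  destruct (proj2 (continuous_eps b t) (cb t) (b t) bt) as [d [d0 Hd]].
  set (x := Rmax 0 (t - d / 2)); set (y := Rmin 1 (t + d / 2)).
  assert (hx : 0 <= x /\ t - d / 2 <= x /\ x <= t).
  { unfold x, Rmax; destruct Rle_dec; lra. }
  assert (hy : y <= 1 /\ y <= t + d / 2 /\ t <= y).
  { unfold y, Rmin; destruct Rle_dec; lra. }
  assert (xy : x < y).
  { unfold x, y, Rmax, Rmin; repeat destruct Rle_dec; lra. }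
  assert (nonneg : forall u v, 0 <= u -> u <= v -> v <= 1 -> 0 <= RInt b u v).
  { intros u v u0 uv v1; apply RInt_ge_0; [exact uv|apply ex_RInt_cont, cb|].
    intros s Hs; apply b0; lra. }
  rewrite <- (RInt_Chasles b 0 x 1), <- (RInt_Chasles b x y 1) by (apply ex_RInt_cont, cb).
  assert (h1 := nonneg 0 x ltac:(lra) ltac:(lra) ltac:(lra)).
  assert (h2 := nonneg y 1 ltac:(lra) ltac:(lra) ltac:(lra)).
  assert (h3 : 0 < RInt b x y).
  { apply RInt_gt_0; [exact xy| |intros; apply cb]; intros s Hs.
    assert (h : Rabs (b s - b t) < b t) by (apply Hd, Rabs_lt_between; lra).
    apply Rabs_lt_between in h; lra. }
  unfold plus; simpl; lra.
Qed.

Lemma exists_primitive (g : R -> R) : (forall t, continuous g t) ->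
  exists Q, Q 0 = 0 /\ forall t, is_derive Q t (g t).
Proof.
  intros cg; exists (fun t => RInt g 0 t); split; [apply (@RInt_point R_CompleteNormedModule)|].
  intros t; apply (is_derive_RInt g (fun t => RInt g 0 t) 0); [|apply cg].
  apply filter_forall; intros s; apply (@RInt_correct R_CompleteNormedModule), ex_RInt_cont, cg.
Qed.

Lemma sin_half_neq_0 omega : 0 < omega ->
  (forall n : nat, (1 <= n)%nat -> omega <> 2 * INR n * PI) -> sin (omega / 2) <> 0.
Proof.
  intros omega0 H s0; destruct (sin_eq_0_0 _ s0) as [k Hk].
  assert (pi := PI_RGT_0).
  assert (k0 : (0 < k)%Z) by (apply lt_IZR; nra).
  apply (H (Z.to_nat k)); [lia|].
  rewrite INR_IZR_INZ, Z2Nat.id by lia; lra.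
Qed.

Theorem theorem3p5 (omega r : R) (f : R -> R -> R) :
  0 < omega ->
  (forall n : nat, (1 <= n)%nat -> omega <> 2 * INR n * PI) ->
  1 <= r ->
  cont_on_rect r f ->
  (forall t u, 0 <= t <= 1 -> -r <= u <= r -> 0 <= f t u) ->
  (forall t u, 0 <= t <= 1 ->
     2 / omega * Rabs (sin (omega / 2)) <= Rabs u <= r -> 0 < f t u) ->
  forall p : R, 1 <= p ->
  exists lam : R, 0 < lam /\
    exists x : R -> R,
      is_periodic_solution omega lam f x /\
      (forall t, 0 <= t <= 1 -> -r <= x t <= r) /\
      Lp_norm01 p x = 2 / omega * Rabs (sin (omega / 2)).
Proof.
  intros omega0 omega_ne r1 cf f0 fpos p p1.
  assert (sin0 := sin_half_neq_0 omega omega0 omega_ne).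
  assert (as0 := Rabs_pos_lt _ sin0).
  set (rho := 2 / omega * Rabs (sin (omega / 2))) in *.
  assert (rho0 : 0 < rho) by (apply Rmult_lt_0_compat; [apply Rdiv_lt_0_compat|]; lra).
  set (aD := Rabs (2 * omega * sin (omega / 2))).
  assert (aDE : aD = 2 * omega * Rabs (sin (omega / 2))) by (apply Rabs_green_denominator, omega0).
  assert (aD0 : 0 < aD) by (rewrite aDE; apply Rmult_lt_0_compat; lra).
  pose (Psi := fun (y : R -> R) t => extend r f t (rho / Lp_norm01 p y * y t)).
  assert (mu0 : 0 < / omega ^ 2) by (apply Rinv_0_lt_compat, pow_lt, omega0).
  assert (cPsi : forall y, (forall t, continuous y t) -> forall t, continuous (Psi y) t).
  { intros y cy; apply continuous_extend_comp; [lra|exact cf|].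
    intros t; apply (continuous_scal_r (rho / Lp_norm01 p y) y), cy. }
  assert (Psi0 : forall y t, 0 <= t <= 1 -> 0 <= Psi y t).
  { intros y t Ht; apply f0; apply clamp_in; lra. }
  destruct (kernel_eigenfunction (green omega) (/ aD) (omega / aD) (/ omega ^ 2) Psi)
    as [y [yL [yB [ymu yeq]]]]; auto.
  { left; apply Rdiv_lt_0_compat; auto. }
  { intros t s; apply green_bound; auto. }
  { intros s; apply green_lipschitz_l; auto. }
  { intros t; apply green_lipschitz_r; auto. }
  { intros s Hs; apply green_mean; auto. }
  { intros y cy yB ymu; apply (extend_normalized_continuous r f) with (/ aD); auto; lra. }
  assert (cy := lipschitz_continuous _ y yL).
  assert (ny : / omega ^ 2 <= Lp_norm01 p y).
  { rewrite <- ymu; apply Lp_norm01_ge_mean; auto; rewrite ymu; exact mu0. }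
  set (K := rho / Lp_norm01 p y).
  assert (K0 : 0 < K) by (apply Rdiv_lt_0_compat; lra).
  assert (cKy : forall t, continuous (fun t => K * y t) t)
    by (intros t; apply (continuous_scal_r K y), cy).
  assert (nKy : Lp_norm01 p (fun t => K * y t) = rho).
  { rewrite Lp_norm01_scal; auto; [unfold K; field; lra|lra]. }
  assert (Ky1 : forall t, Rabs (K * y t) <= 1).
  { intros t; rewrite Rabs_mult, (Rabs_pos_eq K) by lra.
    (* The prescribed norm makes omega^2 rho equal to |D|, so K <= rho omega^2 and |y| <= 1 / |D|
       multiply to exactly 1. *)
    replace 1 with ((rho * omega ^ 2) * / aD) by (rewrite aDE; unfold rho; field; lra).
    apply Rmult_le_compat; [lra|apply Rabs_pos| |apply yB].
    unfold K, Rdiv; apply Rmult_le_compat_l; [lra|].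
    rewrite <- (Rinv_inv (omega ^ 2)); apply Rinv_le_contravar; auto. }
  set (b := Psi y) in *.
  assert (cb : forall t, continuous b t) by (apply cPsi, cy).
  assert (bE : forall t, 0 <= t <= 1 -> b t = f t (K * y t)).
  { intros t Ht; apply extend_id; [exact Ht|]; specialize (Ky1 t); fold K; lra. }
  destruct (Lp_norm01_attained p p1 (fun t => K * y t) rho cKy) as [t0 [Ht0 rt0]]; [lra|exact nKy|].
  assert (M0 : 0 < RInt b 0 1).
  { apply RInt_gt_0_point with t0; auto; [intros s Hs; apply Psi0, Hs|].
    rewrite bE by exact Ht0; apply fpos; [exact Ht0|split; [exact rt0|specialize (Ky1 t0); lra]]. }
  set (M := RInt b 0 1) in *.
  assert (ctrig : forall (h : R -> R), (forall s, ex_derive h s) ->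
    forall s, continuous (fun s => h s * b s) s).
  { intros h dh s; apply (continuous_mult h b); [|apply cb].
    apply (@ex_derive_continuous R_AbsRing R_NormedModule), dh. }
  destruct (exists_primitive (fun s => cos (omega * s) * b s)) as [C [C0 dC]].
  { apply (ctrig (fun s => cos (omega * s))); intros; auto_derive; auto. }
  destruct (exists_primitive (fun s => sin (omega * s) * b s)) as [S [S0 dS]].
  { apply (ctrig (fun s => sin (omega * s))); intros; auto_derive; auto. }
  (* Since M y is the image of [b] under the kernel, K y is K / M times that image. *)
  set (lam := K / M); assert (lam0 : 0 < lam) by (apply Rdiv_lt_0_compat; auto).
  assert (xE : forall t, 0 <= t <= 1 -> lam * response omega C S t = K * y t).
  { intros t Ht; rewrite <- (green_integral omega omega0 sin0 b C S dC dS t cb C0 S0 Ht).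
    rewrite <- yeq by exact Ht; unfold lam; field; lra. }
  assert (d1 := is_derive_response omega omega0 sin0 b C S dC dS).
  assert (d2 := is_derive_response' omega omega0 sin0 b C S dC dS).
  exists lam; split; [exact lam0|].
  (* Not K y itself: derivatives at 0 and 1 are two-sided, and outside [0,1] [y] is only known to be
     Lipschitz, whereas [response] is differentiable on the whole line. *)
  exists (fun t => lam * response omega C S t); split; [|split].
  - exists (fun t => lam * response' omega C S t),
      (fun t => lam * (b t - omega ^ 2 * response omega C S t)); split; [|split].
    + intros t _; split; [|split].
      * apply (is_derive_scal (response omega C S)), d1.
      * apply (is_derive_scal (response' omega C S)), d2.
      * apply (continuous_scal_r lam (fun t => b t - omega ^ 2 * response omega C S t)).
        apply (continuous_minus b); [apply cb|].
        apply (continuous_scal_r (omega ^ 2) (response omega C S)).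
        apply (@ex_derive_continuous R_AbsRing R_NormedModule); eexists; apply d1.
    + intros t Ht; rewrite xE, <- bE by exact Ht.
      rewrite <- xE by exact Ht; ring.
    + destruct (response_periodic omega omega0 sin0 C S C0 S0) as [-> ->]; auto.
  - intros t Ht; rewrite xE by exact Ht; specialize (Ky1 t).
    apply Rabs_le_between in Ky1; lra.
  - rewrite <- nKy; unfold Lp_norm01; f_equal; apply RInt_ext; intros t Ht.
    rewrite Rmin_left, Rmax_right in Ht by lra; rewrite xE by lra; reflexivity.
Qed.
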